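(* Let $\gamma>-1$ and let $n\ge0$ be an integer. For all $z,w\in\mathbb{B}^2$, $$K_n^V(Qz,Qw)=K_{2n}^{B,+}(z,w),$$ where $K_{2n}^{B,+}(z,w)=\frac12\bigl(K_{2n}^B(z,w)+K_{2n}^B(z,-w)\bigr)$.
   Context: $V=\{(x,y,t)\in\mathbb{R}^3:x^2+y^2=t^2,\ 0\le t\le1\}$, parametrized by $(x,y,t)=(t\cos\phi,t\sin\phi,t)$, with the probability measure $d\nu_\gamma(t,\phi)=\frac{\gamma+1}{2\pi}(1-t)^\gamma\,dt\,d\phi$ on $0\le t\le1$, $0\le\phi<2\pi$. $\mathbb{B}^2=\{(u,v)\in\mathbb{R}^2:u^2+v^2\le1\}$ carries the probability measure $d\mu_\gamma(u,v)=\frac{\gamma+1}{\pi}(1-u^2-v^2)^\gamma\,du\,dv$. The map $Q:\mathbb{B}^2\to V$ is $Q(u,v)=(u^2-v^2,\,2uv,\,u^2+v^2)$. $\Pi_m(V)$ (resp. $\Pi_m(\mathbb{B}^2)$) is the space of restrictions to $V$ (resp. $\mathbb{B}^2$) of polynomials in three (resp. two) real variables of total degree at most $m$. $K_n^V$ is the reproducing kernel of $\Pi_n(V)$ in $L^2(V,\nu_\gamma)$ and $K_m^B$ is the reproducing kernel of $\Pi_m(\mathbb{B}^2)$ in $L^2(\mathbb{B}^2,\mu_\gamma)$ (each is $\sum_\ell P_\ell(\cdot)\overline{P_\ell(\cdot)}$ over an orthonormal basis of the space). *)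

(* Defs.v *)
From mathcomp Require Import all_boot all_order all_algebra.
From mathcomp Require Import all_classical all_reals all_analysis.
From mathcomp Require Import complex.
From mathcomp Require mpoly.
(* The notations of mpoly clash with those of mathcomp-analysis. *)
Import -(notations) mpoly.

Set Implicit Arguments.
Unset Strict Implicit.
Unset Printing Implicit Defensive.

Import Order.TTheory GRing.Theory Num.Theory.
Import numFieldNormedType.Exports.

Local Open Scope classical_set_scope.
Local Open Scope complex_scope.
Local Open Scope ring_scope.

Section reproducing_kernel.
Context {R : realType} {d : measure_display} {T : measurableType d}.
Variable mu : set T -> \bar R.

Definition cintegral (D : set T) (f : T -> R[i]) : R[i] :=
  fine (\int[mu]_(x in D) (complex.Re (f x))%:E)%E +i*
  fine (\int[mu]_(x in D) (complex.Im (f x))%:E)%E.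

Definition inner (D : set T) (f g : T -> R[i]) : R[i] :=
  cintegral D (fun x => f x * (g x)^*).

(* The space Pi_m(D): functions are only constrained on D, where two of them
   are identified when they agree; [coord] gives the real coordinates.  In
   [mpoly], [msize p] is the total degree plus one, and [msize 0 = 0]. *)
Definition poly_space (r : nat) (coord : T -> 'I_r -> R) (D : set T) (m : nat) :
    set (T -> R[i]) :=
  [set f | exists2 p : mpoly r R[i], (msize p <= m.+1)%N &
           forall x, D x -> f x = meval (fun i => (coord x i)%:C) p].

Definition orthonormal_basis (D : set T) (E : set (T -> R[i])) (N : nat)
    (P : 'I_N -> T -> R[i]) : Prop :=
  [/\ forall l, E (P l),
      forall k l, inner D (P k) (P l) = (k == l)%:R
    & forall f, E f -> exists c : 'I_N -> R[i],
        forall x, D x -> f x = \sum_(l < N) c l * P l x].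

(* K is determined on D x D only. *)
Definition reproducing_kernel (D : set T) (E : set (T -> R[i]))
    (K : T -> T -> R[i]) : Prop :=
  exists (N : nat) (P : 'I_N -> T -> R[i]), orthonormal_basis D E P /\
    forall x y, D x -> D y -> K x y = \sum_(l < N) P l x * (P l y)^*.

End reproducing_kernel.

Section cone_and_disc.
Context {R : realType}.
Local Notation leb2 := (@lebesgue_measure R \x @lebesgue_measure R)%E.

Definition cone : set (R * R * R) :=
  [set p | p.1.1 ^+ 2 + p.1.2 ^+ 2 = p.2 ^+ 2 /\ 0 <= p.2 <= 1].

Definition cone_coord (p : R * R * R) : 'I_3 -> R :=
  tnth [tuple p.1.1; p.1.2; p.2].

Definition cone_param (s : R * R) : R * R * R :=
  (s.1 * cos s.2, s.1 * sin s.2, s.1).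

Definition cone_param_measure (gamma : R) (A : set (R * R)) : \bar R :=
  (\int[leb2]_(s in A `&` (`[0%R, 1%R] `*` `[0%R, (2 * pi)%R[))
     ((gamma + 1) / (2 * pi) * (1 - s.1) `^ gamma)%:E)%E.

Definition cone_measure (gamma : R) : set (R * R * R) -> \bar R :=
  pushforward (cone_param_measure gamma) cone_param.

Definition disc : set (R * R) := [set z | z.1 ^+ 2 + z.2 ^+ 2 <= 1].

Definition disc_coord (z : R * R) : 'I_2 -> R := tnth [tuple z.1; z.2].

Definition disc_measure (gamma : R) (A : set (R * R)) : \bar R :=
  (\int[leb2]_(z in A `&` disc)
     ((gamma + 1) / pi * (1 - z.1 ^+ 2 - z.2 ^+ 2) `^ gamma)%:E)%E.

Definition Q (z : R * R) : R * R * R :=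
  (z.1 ^+ 2 - z.2 ^+ 2, 2 * z.1 * z.2, z.1 ^+ 2 + z.2 ^+ 2).

Definition cone_kernel (gamma : R) (n : nat) :
    (R * R * R -> R * R * R -> R[i]) -> Prop :=
  reproducing_kernel (cone_measure gamma) cone (poly_space cone_coord cone n).

Definition disc_kernel (gamma : R) (m : nat) :
    (R * R -> R * R -> R[i]) -> Prop :=
  reproducing_kernel (disc_measure gamma) disc (poly_space disc_coord disc m).

Definition even_part (K : R * R -> R * R -> R[i]) (z w : R * R) : R[i] :=
  2^-1 * (K z w + K z (- w)).

End cone_and_disc.

(* Main.v *)
Require Import Defs.
From HB Require Import structures.
From mathcomp Require Import all_boot all_order all_algebra.
From mathcomp Require Import all_classical all_reals all_analysis.
From mathcomp Require Import measurable_realfun complex.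
From mathcomp Require Import ring lra zify.
From mathcomp Require mpoly.

(** [Q] doubles polar angles and squares radii, so it maps the disc two-to-one
    onto the cone and carries [mu_gamma] to [nu_gamma].  Hence [f |-> f \o Q] is an
    isometry from [Pi_n(V)] into [Pi_2n(B)], and since [u^2], [uv] and [v^2] are
    the linear forms [(x + t) / 2], [y / 2] and [(t - x) / 2] of [Q(u, v)], its
    image consists of the even polynomials.  Expand the even part of an
    orthonormal basis [B] of [Pi_2n(B)] in the pulled back basis [P \o Q]:
    [E_m = \sum_l c_ml (P_l \o Q)].  As [mu_gamma] is symmetric,
    [<P_l \o Q, B_m> = <P_l \o Q, E_m>], i.e. [P_l \o Q = \sum_m c_ml^* B_m], and
    both kernels equal [\sum_(m, l) c_ml^* B_m(z) P_l(Qw)^*].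

    The change of variables is done without polar coordinates: on the half disc
    [v > 0] put [u = - v s], so that [Q(u, v)] has height [t = v^2 (1 + s^2)] and
    angle [phi = pi + 2 atan s], and apply Tonelli's theorem together with
    one-dimensional substitutions in [u], [v] and [s]. *)

Set Implicit Arguments.
Unset Strict Implicit.
Unset Printing Implicit Defensive.

Import Order.TTheory GRing.Theory Num.Theory.
Import numFieldNormedType.Exports.

Local Open Scope classical_set_scope.
Local Open Scope ring_scope.

(** * Changes of variables *)

Section weighted_pushforward.
Local Open Scope ereal_scope.
Context d1 d2 (T1 : measurableType d1) (T2 : measurableType d2) (R : realType).
Variables (m : {measure set T1 -> \bar R}) (phi : T1 -> T2) (D : set T1)
  (rho : T1 -> R).
Hypotheses (mphi : measurable_fun setT phi) (mD : measurable D)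
  (mrho : measurable_fun D rho) (rho0 : forall x, D x -> (0 <= rho x)%R).

(** The image under [phi] of the measure with density [rho] on [D]. [disc_measure] has this form
    with [phi] the identity, and [cone_measure] with [phi] equal to [cone_param]; Lebesgue-Stieltjes
    measures also arise this way. *)
Definition weighted_pushforward (A : set T2) : \bar R :=
  \int[m]_(x in phi @^-1` A `&` D) (rho x)%:E.

Let mphiD A : measurable A -> measurable (phi @^-1` A).
Proof. by move=> mA; rewrite -[_ @^-1` _]setTI; exact: mphi. Qed.

Let wp0 : weighted_pushforward set0 = 0.
Proof. by rewrite /weighted_pushforward preimage_set0 set0I integral_set0. Qed.

Let wp_ge0 A : 0 <= weighted_pushforward A.
Proof. by apply: integral_ge0 => x [_ Dx]; rewrite lee_fin rho0. Qed.

Let wp_sigma_additive : semi_sigma_additive weighted_pushforward.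
Proof.
move=> F mF tF mUF; rewrite /weighted_pushforward preimage_bigcup setI_bigcupl.
rewrite ge0_integral_bigcup//=.
- apply: is_cvg_nneseries => n _ _.
  by apply: integral_ge0 => x [_ Dx]; rewrite lee_fin rho0.
- by move=> k; apply: measurableI => //; exact: mphiD.
- rewrite -setI_bigcupl; apply/measurable_EFinP; apply: measurable_funS mrho => //.
- by move=> x [k _ [_ Dx]]; rewrite lee_fin rho0.
- apply/trivIsetP => i j _ _ ij; rewrite setIACA -preimage_setI.
  by move/trivIsetP : tF => -> //; rewrite preimage_set0 set0I.
Qed.

(** A bundled measure that agrees with the bare set function: rewriting with the equality makes
    integration theory available for [cone_measure] and [disc_measure], which are plain functions on
    sets. *)
Lemma weighted_pushforward_measure :
  {nu : {measure set T2 -> \bar R} | forall A, nu A = weighted_pushforward A}.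
Proof.
pose mix := isMeasure.Build _ _ _ weighted_pushforward wp0 wp_ge0
  wp_sigma_additive.
pose nu : {measure set T2 -> \bar R} := HB.pack weighted_pushforward mix.
by exists nu.
Qed.

Import HBNNSimple.

(** Monotone convergence along simple approximations of [h], on both sides, reduces the formula to
    indicators, where it is the definition of [weighted_pushforward]. Agreement of [nu] is asked on
    measurable sets only, since uniqueness theorems for measures give no more. *)
Lemma ge0_integralT_weighted_pushforward (nu : {measure set T2 -> \bar R})
    (h : T2 -> \bar R) :
  (forall A, measurable A -> nu A = weighted_pushforward A) ->
  measurable_fun setT h -> (forall y, 0 <= h y) ->
  \int[nu]_y h y = \int[m]_(x in D) (h (phi x) * (rho x)%:E).
Proof.
move=> nuE mh h0; pose f_ := nnsfun_approx measurableT mh.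
have mf n : measurable_fun D (fun x => (f_ n (phi x) * rho x)%:E).
  apply/measurable_EFinP/measurable_funM => //.
  by apply: measurable_funTS; apply: measurableT_comp.
transitivity (limn (fun n => \int[nu]_x (f_ n x)%:E)).
  rewrite -monotone_convergence//.
  - apply: eq_integral => y _; apply/esym/cvg_lim => //.
    by apply: cvg_nnsfun_approx.
  - by move=> n; exact/measurable_EFinP/measurable_funP.
  - by move=> n y _; rewrite lee_fin.
  - by move=> y _ n k nk; rewrite lee_fin; exact/lefP/nd_nnsfun_approx.
transitivity (limn (fun n => \int[m]_(x in D) (f_ n (phi x) * rho x)%:E)); last first.
  rewrite -monotone_convergence//.
  - apply: eq_integral => x; rewrite inE => Dx; apply/cvg_lim => //.
    under eq_fun do rewrite EFinM.
    apply: cvgeZr => //.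
    by apply: cvg_nnsfun_approx.
  - by move=> n x Dx; rewrite lee_fin mulr_ge0// rho0.
  - move=> x Dx n k nk; rewrite lee_fin ler_wpM2r ?rho0//.
    by exact/lefP/nd_nnsfun_approx.
apply: congr_lim; apply/funext => n.
transitivity (\sum_(k \in range (f_ n)) k%:E * nu (f_ n @^-1` [set k])).
  by rewrite integralT_nnsfun sintegralE.
transitivity (\sum_(k \in range (f_ n))
    \int[m]_(x in D) (k * (\1_(f_ n @^-1` [set k]) (phi x) * rho x))%:E).
  apply: eq_fsbigr => r; rewrite inE => -[y _ <-].
  under [RHS]eq_integral do rewrite EFinM.
  rewrite ge0_integralZl_EFin//; last 2 first.
  - by move=> x Dx; rewrite lee_fin mulr_ge0 ?rho0.
  - apply/measurable_EFinP/measurable_funM => //; apply: measurable_funTS.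
    by apply: measurableT_comp => //; exact: measurable_indic.
  congr (_ * _); rewrite nuE// /weighted_pushforward setIC integral_mkcondr.
  apply: eq_integral => x _; rewrite patchE indicE /=.
  have -> : (x \in phi @^-1` (f_ n @^-1` [set f_ n y])) =
            (phi x \in f_ n @^-1` [set f_ n y]) by [].
  by case: ifPn => _; rewrite ?mul1r ?mul0r.
rewrite -ge0_integral_fsum//.
- apply: eq_integral => x _; rewrite fsumEFin//; congr EFin.
  by rewrite [in RHS]fimfunE mulrC mulr_fsumr; apply: eq_fsbigr => k _; ring.
- move=> r; apply/measurable_EFinP/measurable_funM => //.
  apply: measurable_funM => //; apply: measurable_funTS.
  by apply: measurableT_comp => //; exact: measurable_indic.
- move=> r x Dx; rewrite mulrA EFinM; apply: mule_ge0; last first.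
    by rewrite lee_fin rho0.
  by rewrite EFinM nnfun_muleindic_ge0.
Qed.

Lemma ge0_integral_weighted_pushforward (nu : {measure set T2 -> \bar R})
    (E : set T2) (h : T2 -> \bar R) :
  (forall A, measurable A -> nu A = weighted_pushforward A) ->
  measurable E -> measurable_fun E h -> (forall y, E y -> 0 <= h y) ->
  \int[nu]_(y in E) h y =
  \int[m]_(x in phi @^-1` E `&` D) (h (phi x) * (rho x)%:E).
Proof.
move=> nuE mE mh h0; rewrite integral_mkcond.
rewrite ge0_integralT_weighted_pushforward//; last 2 first.
- exact/(measurable_restrictT _ mE).
- by move=> y; exact: erestrict_ge0.
rewrite setIC integral_mkcondr; apply: eq_integral => x _.
rewrite !patchE; have -> : (phi x \in E) = (x \in phi @^-1` E) by [].
by case: ifPn => // _; rewrite mul0e.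
Qed.

End weighted_pushforward.

Section change_of_variables.
Context {R : realType}.
Local Notation mu := (@lebesgue_measure R).

(* Both sides are [\int[nu] (h \o F)], where [nu] is the Lebesgue-Stieltjes measure
   of [F]: it has density [f], and it is the image under [G] of the Lebesgue
   measure on [D]. *)
Lemma ge0_change_of_variables (F G f : R -> R) (D : set R) (h : R -> \bar R) :
  is_interval D -> (forall x, D (F x)) -> cancel F G ->
  (forall y, D y -> F (G y) = y) -> measurable_fun setT G ->
  {homo F : x y / x < y} -> (forall x : R, is_derive x 1 F (f x)) ->
  continuous f -> (forall x, 0 <= f x) ->
  measurable_fun D h -> (forall y, D y -> 0 <= h y)%E ->
  (\int[mu]_(y in D) h y = \int[mu]_x (h (F x) * (f x)%:E))%E.
Proof.
move=> iD DF FK GK mG Fincr dF cf f0 mh h0.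
have mD : measurable D by exact: is_interval_measurable.
have cF : continuous F.
  by move=> x; apply/differentiable_continuous/derivable1_diffP; case: (dF x).
have mF : measurable_fun setT F by exact: continuous_measurable_fun.
have mf : measurable_fun setT f by exact: continuous_measurable_fun.
have [nu1 nu1E] := @weighted_pushforward_measure _ _ (measurableTypeR R)
  (measurableTypeR R) R mu idfun setT f (@measurable_id _ _ _) measurableT mf
  (fun x _ => f0 x).
have [nu2 nu2E] := @weighted_pushforward_measure _ _ (measurableTypeR R)
  (measurableTypeR R) R mu G D (fun=> 1) mG mD (measurable_cst _)
  (fun x _ => ler01).
have Fmono : {mono F : x y / x <= y} by exact: le_mono.
have ndF : {homo F : x y / x <= y} by move=> x y; rewrite Fmono.
have rcF : right_continuous F.
  by move=> x; exact: (cvg_at_right_filter (cF x)).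
pose Fc : cumulative R R := HB.pack F (isCumulative.Build R _ R F ndF rcF).
(* [nu1] assigns to []a, b]] the integral of [f] over it, which is [F b - F a] by the fundamental
   theorem of calculus. *)
have LS1 X : ocitv X -> lebesgue_stieltjes_measure Fc X = nu1 X.
  move=> [[a b] _ <-] /=.
  rewrite nu1E /weighted_pushforward setIT /=.
  have [ab|ba] := ltP a b; last first.
    by rewrite set_itv_ge ?bnd_simp -?leNgt// measure0 preimage_set0 integral_set0.
  rewrite /lebesgue_stieltjes_measure /measure_extension measurable_mu_extE/=; last exact: is_ocitv.
  rewrite wlength_itv_bnd ?(ltW ab)//.
  rewrite (_ : idfun @^-1` _ = `]a, b]%classic)//.
  rewrite integral_itv_obnd_cbnd; last first.
    exact/measurable_EFinP/measurable_funTS.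
  rewrite (@continuous_FTC2 _ f F)//.
  - exact/continuous_subspaceT.
  - split; first by move=> x _; case: (dF x).
    + exact: (cvg_at_right_filter (cF a)).
    + exact: (cvg_at_left_filter (cF b)).
  - by move=> x _; rewrite derive1E; case: (dF x).
(* [nu2] assigns to []a, b]] the length of []F a, F b]], which lies in [D] because [D] is an
   interval containing both endpoints. *)
have LS2 X : ocitv X -> lebesgue_stieltjes_measure Fc X = nu2 X.
  move=> [[a b] _ <-] /=.
  rewrite nu2E /weighted_pushforward /=.
  have [ab|ba] := ltP a b; last first.
    by rewrite set_itv_ge ?bnd_simp -?leNgt// measure0 preimage_set0 set0I integral_set0.
  rewrite /lebesgue_stieltjes_measure /measure_extension measurable_mu_extE/=; last exact: is_ocitv.
  rewrite wlength_itv_bnd ?(ltW ab)//.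
  have -> : G @^-1` `]a, b] `&` D = `]F a, F b]%classic.
    apply/seteqP; split => y /=; rewrite !in_itv/=.
      by move=> [/andP[aG Gb] Dy]; rewrite -(GK _ Dy) Fincr// Fmono.
    move=> /andP[ay yb].
    have Dy : D y by apply: (iD (F a) (F b)) => //; rewrite (ltW ay).
    split => //; move: ay yb; rewrite -{1 2}(GK _ Dy) Fmono => + ->.
    by rewrite (leW_mono Fmono) => ->.
  transitivity (mu (`]F a, F b]%classic : set R)).
    by rewrite lebesgue_measure_itv/= lte_fin Fincr.
  by rewrite (@integral_cst _ (measurableTypeR R)) ?mul1e//; exact: measurable_itv.
(* Half-open intervals determine the measure, so agreement on them extends to all measurable
   sets. *)
have nuE A : measurable A -> nu1 A = nu2 A.
  move=> mA; rewrite -(@lebesgue_stieltjes_measure_unique _ Fc nu1)//.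
  exact: lebesgue_stieltjes_measure_unique.
pose k := h \_ D.
have mk : measurable_fun setT k by exact/(measurable_restrictT _ mD).
have k0 y : (0 <= k y)%E by exact: erestrict_ge0.
have mkF : measurable_fun setT (k \o F) by exact: measurableT_comp.
have kF x : k (F x) = h (F x) by rewrite /k patchE mem_set.
(* Read with density [f], this integral is the right-hand side. Read as an integral against the
   image under [G], it is the left-hand side, because [F (G y) = y] on [D]. *)
transitivity (\int[nu1]_y (k (F y)))%E; last first.
  rewrite (@ge0_integralT_weighted_pushforward _ _
    (measurableTypeR R) (measurableTypeR R) R mu idfun setT f)//.
    by apply: eq_integral => x _; rewrite kF.
  exact: measurable_id.
have nu1E2 A : measurable A -> nu1 A = weighted_pushforward mu G D (fun=> 1) A.
  by move=> mA; rewrite nuE// nu2E.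
have -> := @ge0_integralT_weighted_pushforward _ _ (measurableTypeR R)
  (measurableTypeR R) R mu G D (fun=> 1) mG mD (measurable_cst _)
  (fun x _ => ler01) nu1 (k \o F) nu1E2 mkF (fun y => k0 (F y)).
by apply: eq_integral => y; rewrite inE => Dy /=; rewrite kF GK// mule1.
Qed.

(** Lebesgue measure is its own image under negation. *)
Lemma ge0_integral_oppr (h : R -> \bar R) :
  measurable_fun setT h -> (forall y, 0 <= h y)%E ->
  (\int[mu]_y h y = \int[mu]_y h (- (y : R))%R)%E.
Proof.
move=> mh h0.
have mN : measurable_fun setT (-%R : measurableTypeR R -> measurableTypeR R).
  exact: oppr_measurable.
rewrite -[RHS](@ge0_integral_pushforward _ _ (measurableTypeR R) (measurableTypeR R) R _ mN mu setT h)//.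
by apply: eq_measure_integral => A mA _; exact/esym/lebesgue_measureN.
Qed.

End change_of_variables.

(** * Substitutions by scaling, exponential, square and half angle *)

Section substitutions.
Context {R : realType}.
Local Notation mu := (@lebesgue_measure R).
Implicit Types h : R -> \bar R.

(** The sign is that of [u = - v s]. The reflection is carried out first because
    [ge0_change_of_variables] takes an increasing map. *)
Lemma ge0_integral_scale (v : R) h : 0 < v ->
  measurable_fun setT h -> (forall y, 0 <= h y)%E ->
  (\int[mu]_y h y = \int[mu]_s (h (- (v * s))%R * v%:E))%E.
Proof.
move=> v0 mh h0; rewrite ge0_integral_oppr//.
have mhN : measurable_fun setT (fun y : R => h (- y)).
  by apply: measurableT_comp => //; exact: oppr_measurable.
apply: (@ge0_change_of_variables _ (fun s => v * s) (fun y => y / v)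
    (fun=> v) setT (fun y => h (- y))) => //.
- by move=> s; rewrite mulrC mulKf ?gt_eqF.
- by move=> y _; rewrite mulrC divfK ?gt_eqF.
- exact: mulrr_measurable.
- by move=> x y xy; rewrite ltr_pM2l.
- move=> x; have -> : (fun s => v * s) = v \*: (@id R) by [].
  by apply: is_derive_eq; rewrite /GRing.scale/= mulr1.
- by move=> x; exact: cst_continuous.
- by move=> _; exact: ltW.
Qed.

Lemma ge0_integral_exp h :
  measurable_fun setT h -> (forall y : R, (0 < y)%R -> 0 <= h y)%E ->
  (\int[mu]_(y in `]0%R, +oo[) h y = \int[mu]_s (h (expR s) * (expR s)%:E))%E.
Proof.
move=> mh h0; apply: (@ge0_change_of_variables _ expR (@ln R) expR (`]0, +oo[ : set R) h) => //.
- exact: interval_is_interval.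
- by move=> x /=; rewrite in_itv/= expR_gt0.
- exact: expRK.
- by move=> y /=; rewrite in_itv/= andbT => y0; rewrite lnK.
- by move=> x y xy; rewrite ltr_expR.
- exact: continuous_expR.
- exact: measurable_funTS.
- by move=> y /=; rewrite in_itv/= andbT; exact: h0.
Qed.

(* Both sides reduce to integrals over the whole line, by [y = c exp(2 s)] and
   [v = exp s]. *)
Lemma ge0_integral_sqr (c : R) h : 0 < c ->
  measurable_fun setT h -> (forall y, 0 <= h y)%E ->
  (\int[mu]_(y in `]0%R, +oo[) h y =
   \int[mu]_(v in `]0%R, +oo[) (h (v ^+ 2 * c)%R * (2 * c * v)%:E))%E.
Proof.
move=> c0 mh h0; rewrite [RHS]ge0_integral_exp; last 2 first.
- apply: emeasurable_funM; last first.
    by apply/measurable_EFinP; apply: measurable_funM.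
  apply: measurableT_comp => //; apply: measurable_funM => //.
- by move=> y y0; rewrite mule_ge0 ?h0 ?lee_fin ?mulr_ge0 ?mulr_gt0 ?exprn_gt0// ltW.
have dF (s : R) : is_derive s 1 (fun s : R => expR s ^+ 2 * c) (2 * c * expR s ^+ 2).
  rewrite (_ : (fun s => _) = c \*: ((@expR R) ^+ 2)); last first.
    by apply/funext => x; rewrite mulrC.
  by apply: is_derive_eq; rewrite /GRing.scale/=; ring.
rewrite (@ge0_change_of_variables _ (fun s => expR s ^+ 2 * c)
  (fun y => ln (y / c) / 2) (fun s => 2 * c * expR s ^+ 2) (`]0, +oo[ : set R)
  h _ _ _ _ _ _ dF).
- apply: eq_integral => s _; rewrite -muleA -EFinM; congr (_ * _%:E)%E.
  by ring.
- exact: interval_is_interval.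
- by move=> x /=; rewrite in_itv/= andbT mulr_gt0 ?exprn_gt0 ?expR_gt0.
- move=> s /=; rewrite mulfK ?gt_eqF// lnXn ?expR_gt0// expRK.
  by rewrite -(mulr_natr s) mulfK.
- move=> y /=; rewrite in_itv/= andbT => y0.
  rewrite -expRM_natl mulrCA mulfV// mulr1 lnK ?divfK ?gt_eqF//.
  by rewrite posrE divr_gt0.
- apply: measurable_funM => //; apply: measurableT_comp => //.
  exact: mulrr_measurable.
- by move=> x y xy; rewrite ltr_pM2r// ltr_pXn2r ?nnegrE ?expR_ge0// ltr_expR.
- move=> x; apply: cvgM; first exact: cvg_cst.
  apply: (@continuous_comp _ _ _ (@expR R) (fun y => y ^+ 2)).
    exact: continuous_expR.
  exact: exprn_continuous.
- by move=> x; rewrite !mulr_ge0 ?exprn_ge0 ?expR_ge0// ltW.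
- exact: measurable_funTS.
- by move=> y _; exact: h0.
Qed.

(** As [s] runs over the line, [pi + 2 * atan s] increases through the whole open interval, with
    derivative [2 / (1 + s ^+ 2)]. *)
Lemma ge0_integral_angle h :
  measurable_fun setT h -> (forall y, 0 <= h y)%E ->
  (\int[mu]_(y in `]0%R, (2 * pi)%R[) h y =
   \int[mu]_s (h (pi + 2 * atan s)%R * (2 / (1 + s ^+ 2))%:E))%E.
Proof.
move=> mh h0.
have pos (s : R) : 0 < 1 + s ^+ 2 by rewrite ltr_pwDl ?sqr_ge0.
pose D : set R := `]0, (2 * pi)[%classic.
have mD : measurable D by exact: measurable_itv.
pose T (y : R) : R := (y - pi) / 2.
have TD y : D y -> - (pi / 2) < T y < pi / 2.
  by rewrite /D/= in_itv/= /T => /andP[y1 y2]; lra.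
have FD (s : R) : D (pi + 2 * atan s).
  rewrite /D/= in_itv/=; have := atan_gtNpi2 s; have := atan_ltpi2 s; lra.
(* The inverse [tan ((y - pi) / 2)] is extended by zero outside [D]: it has to be measurable on the
   whole line, and on [D] its continuity provides this. *)
apply: (@ge0_change_of_variables _ (fun s => pi + 2 * atan s)
  ((fun y => tan (T y)) \_ D) (fun s => 2 / (1 + s ^+ 2))) => //.
- exact: interval_is_interval.
- move=> s; rewrite patchE mem_set//=.
  by rewrite /T addrAC subrr add0r mulrC mulKf// atanK.
- move=> y Dy; rewrite patchE mem_set//= tanK//; first by rewrite /T; lra.
  by rewrite in_itv/= TD.
- apply/(measurable_restrictT _ mD).
  apply: open_continuous_measurable_fun; first exact: interval_open.
  move=> y; rewrite inE => /TD Ty.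
  apply: continuous_comp; last first.
    by apply: continuous_tan; rewrite gt_eqF// cos_gt0_pihalf.
  apply: cvgM; last exact: cvg_cst.
  by apply: cvgB; [exact: cvg_id|exact: cvg_cst].
- by move=> x y xy; rewrite ltrD2l ltr_pM2l// lt_atan.
- move=> x; apply: is_derive_eq.
  by rewrite /GRing.scale/=; ring.
- move=> x; apply: cvgM; first exact: cvg_cst.
  apply: cvgV; first by rewrite gt_eqF.
  apply: cvgD; first exact: cvg_cst.
  exact: exprn_continuous.
- by move=> x; rewrite divr_ge0// ltW.
- exact: measurable_funTS.
Qed.

End substitutions.

(** * Tonelli's theorem on rectangles, and integrals of even functions *)

Section tonelli_rectangle.
Local Open Scope ereal_scope.
Context d1 d2 (T1 : measurableType d1) (T2 : measurableType d2) (R : realType).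
Variables (m1 : {sigma_finite_measure set T1 -> \bar R})
  (m2 : {sigma_finite_measure set T2 -> \bar R}).
Variables (A : set T1) (B : set T2) (f : T1 * T2 -> \bar R).
Hypotheses (mA : measurable A) (mB : measurable B)
  (mf : measurable_fun setT f) (f0 : forall x y, A x -> B y -> 0 <= f (x, y)).

(** The zero extension is nonnegative everywhere, while [f] is so on the rectangle only. It turns
    integrals over the rectangle into integrals over the whole product, where Tonelli's theorem
    applies. *)
Let g := f \_ (A `*` B).

Let mg : measurable_fun setT g.
Proof.
have mAB : measurable (A `*` B) by exact: measurableX.
by apply/(measurable_restrictT _ mAB); exact: measurable_funTS.
Qed.

Let g0 z : 0 <= g z.
Proof. by apply: erestrict_ge0 => -[x y] [/= Ax By]; exact: f0. Qed.

Let gE x y : g (x, y) = if x \in A then (fun y => f (x, y)) \_ B y else 0.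
Proof. by rewrite /g !patchE in_setX; case: (x \in A). Qed.

Lemma tonelli_rectangle1 : \int[m1 \x m2]_(z in A `*` B) f z =
  \int[m1]_(x in A) \int[m2]_(y in B) f (x, y).
Proof.
rewrite integral_mkcond -/g fubini_tonelli1// [RHS]integral_mkcond.
apply: eq_integral => x _; rewrite /fubini_F patchE.
under eq_integral do rewrite gE.
by case: ifPn => _; [rewrite [RHS]integral_mkcond|rewrite integral0].
Qed.

Lemma tonelli_rectangle2 : \int[m1 \x m2]_(z in A `*` B) f z =
  \int[m2]_(y in B) \int[m1]_(x in A) f (x, y).
Proof.
rewrite integral_mkcond -/g fubini_tonelli2// [RHS]integral_mkcond.
apply: eq_integral => y _; rewrite /fubini_G patchE.
have gE2 x : g (x, y) = if y \in B then (fun x => f (x, y)) \_ A x else 0.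
  by rewrite gE !patchE; case: (x \in A); case: (y \in B).
under eq_integral do rewrite gE2.
by case: ifPn => _; [rewrite [RHS]integral_mkcond|rewrite integral0].
Qed.

Lemma tonelli_rectangle : \int[m1]_(x in A) \int[m2]_(y in B) f (x, y) =
  \int[m2]_(y in B) \int[m1]_(x in A) f (x, y).
Proof. by rewrite -tonelli_rectangle1 tonelli_rectangle2. Qed.

Lemma measurable_tonelli_rectangle :
  measurable_fun A (fun x => \int[m2]_(y in B) f (x, y)).
Proof.
apply: (@eq_measurable_fun _ _ _ _ _ (fubini_F m2 g)).
  move=> x xA; rewrite /fubini_F [RHS]integral_mkcond; apply: eq_integral => y _.
  by rewrite gE xA.
by apply: measurable_funTS; exact: measurable_fun_fubini_tonelli_F.
Qed.

End tonelli_rectangle.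

Section even_integral.
Context {R : realType}.
Local Notation mu := (@lebesgue_measure R).

(** Remove the null point 0 and reflect the negative half-line onto the positive one. *)
Lemma ge0_integral_even (J : R -> \bar R) :
  measurable_fun setT J -> (forall y, 0 <= J y)%E ->
  (forall y : R, J (- y)%R = J y) ->
  (\int[mu]_y J y = 2%:E * \int[mu]_(y in `]0%R, +oo[) J y)%E.
Proof.
move=> mJ J0 JN.
have mpos : measurable (`]0%R, +oo[%classic : set R) by exact: measurable_itv.
have mneg : measurable (`]-oo, 0%R[%classic : set R) by exact: measurable_itv.
have -> : (\int[mu]_y J y = \int[mu]_(y in [set: R] `\` [set 0%R]) J y)%E.
  rewrite integral_setD1//; first exact: measurableD.
  by apply: measurable_funTS.
have -> : [set: R] `\` [set 0%R] = `]-oo, 0%R[%classic `|` `]0%R, +oo[%classic.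
  apply/seteqP; split => x /=; rewrite !in_itv/= andbT.
    by move=> [_ /eqP]; rewrite neq_lt => /orP[]; [left|right].
  by case=> x0; split => //; apply/eqP; [rewrite lt_eqF|rewrite gt_eqF].
rewrite ge0_integral_setU//=; last 2 first.
- exact: measurable_funTS.
- rewrite disj_set2E; apply/eqP/seteqP; split => x //=.
  by rewrite !in_itv/= andbT => -[x0 /(lt_trans x0)]; rewrite ltxx.
suff -> : (\int[mu]_(y in `]-oo, 0%R[) J y = \int[mu]_(y in `]0%R, +oo[) J y)%E.
  by rewrite mule_natl mule2n.
rewrite integral_mkcond ge0_integral_oppr; last 2 first.
- by apply/(measurable_restrictT _ mneg); exact: measurable_funTS.
- by move=> y; exact: erestrict_ge0.
rewrite [RHS]integral_mkcond; apply: eq_integral => y _.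
rewrite !patchE JN; congr (if _ then _ else _).
by apply/idP/idP => /set_mem/= y0; apply/mem_set; move: y0;
  rewrite /= !in_itv/= andbT oppr_lt0.
Qed.

End even_integral.

(** * The change of variables from the cone to the disc *)

Section cone_to_disc.
Context {R : realType}.
Local Notation mu := (@lebesgue_measure R).
Local Notation leb2 := (@lebesgue_measure R \x @lebesgue_measure R)%E.

(** Double-angle formulas at [atan s], whose squared cosine is [1 / (1 + s ^+ 2)]. The shift by [pi]
    changes the sign of both cosine and sine. *)
Lemma Q_half_angle (v s : R) :
  Q (- (v * s), v) = cone_param (v ^+ 2 * (1 + s ^+ 2), pi + 2 * atan s).
Proof.
have pos : 0 < 1 + s ^+ 2 by rewrite ltr_pwDl ?sqr_ge0.
have c0 : cos (atan s) != 0.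
  by rewrite gt_eqF// cos_gt0_pihalf// atan_gtNpi2 atan_ltpi2.
have c2 : cos (atan s) ^+ 2 = (1 + s ^+ 2)^-1.
  by have := cos2_tan2 c0; rewrite atanK => <-; rewrite invrK.
have sc : sin (atan s) = s * cos (atan s).
  by rewrite -{2}(atanK s) /tan divfK.
have cE : cos (pi + 2 * atan s) = 1 - 2 / (1 + s ^+ 2).
  rewrite addrC cosDpi mulr_natl cos_mulr2n c2 -mulr_natl.
  by ring.
have sE : sin (pi + 2 * atan s) = - (2 * s / (1 + s ^+ 2)).
  rewrite addrC sinDpi mulr_natl sin_mulr2n sc -mulr_natl -c2.
  by ring.
rewrite /Q /cone_param /= cE sE.
congr (_, _, _); [field|field|ring]; exact: lt0r_neq0.
Qed.

Variable gamma : R.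
Hypothesis gamma_gt : -1 < gamma.

Definition cone_weight (s : R * R) : R :=
  (gamma + 1) / (2 * pi) * (1 - s.1) `^ gamma.

Definition disc_weight (z : R * R) : R :=
  (gamma + 1) / pi * (1 - z.1 ^+ 2 - z.2 ^+ 2) `^ gamma.

Lemma cone_weight_ge0 s : 0 <= cone_weight s.
Proof.
rewrite mulr_ge0 ?powR_ge0// divr_ge0 ?mulr_ge0 ?pi_ge0//.
by move: gamma_gt; lra.
Qed.

Lemma disc_weight_ge0 z : 0 <= disc_weight z.
Proof.
rewrite mulr_ge0 ?powR_ge0// divr_ge0 ?pi_ge0//.
by move: gamma_gt; lra.
Qed.

Lemma measurable_cone_weight : measurable_fun setT cone_weight.
Proof.
apply: measurable_funM => //.
apply: (measurableT_comp (measurable_powR gamma)).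
exact: measurable_funB.
Qed.

Lemma measurable_disc_weight : measurable_fun setT disc_weight.
Proof.
apply: measurable_funM => //.
apply: (measurableT_comp (measurable_powR gamma)).
apply: measurable_funB => //; last exact: measurable_funX.
by apply: measurable_funB => //; exact: measurable_funX.
Qed.

Lemma measurable_Q : measurable_fun setT (@Q R).
Proof.
apply: measurable_fun_pair; first apply: measurable_fun_pair => /=.
- by apply: measurable_funB; apply: measurable_funX.
- by apply: measurable_funM => //; apply: measurable_funM.
- by apply: measurable_funD; apply: measurable_funX.
Qed.

Lemma measurable_cone_param : measurable_fun setT (@cone_param R).
Proof.
have mcos : measurable_fun setT (@cos R).
  by apply: continuous_measurable_fun; exact: continuous_cos.
have msin : measurable_fun setT (@sin R).
  by apply: continuous_measurable_fun; exact: continuous_sin.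
apply: measurable_fun_pair => //; apply: measurable_fun_pair => /=.
- by apply: measurable_funM => //; exact: measurableT_comp.
- by apply: measurable_funM => //; exact: measurableT_comp.
Qed.

Lemma measurable_disc : measurable (@disc R).
Proof.
have mf : measurable_fun setT (fun z : R * R => z.1 ^+ 2 + z.2 ^+ 2).
  by apply: measurable_funD; apply: measurable_funX.
have -> : @disc R =
    setT `&` (fun z : R * R => z.1 ^+ 2 + z.2 ^+ 2) @^-1` `]-oo, 1].
  by apply/seteqP; split => z; rewrite /disc/= in_itv/=; tauto.
exact: mf.
Qed.

(** In the variables [(v, s)] the cone integral acquires the Jacobian [4 v]. The half disc, with
    [du = v ds], has Jacobian [v]; a factor 2 comes from the normalizing constants and another 2
    from the two half discs. *)
Lemma ge0_integral_cone_disc (g : R * R * R -> \bar R) :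
  measurable_fun setT g -> (forall p, 0 <= g p)%E ->
  (\int[leb2]_(s in `[0%R, 1%R] `*` `[0%R, (2 * pi)%R[)
      (g (cone_param s) * (cone_weight s)%:E) =
   \int[leb2]_(z in disc) (g (Q z) * (disc_weight z)%:E))%E.
Proof.
move=> mg g0.
pose G (s : R * R) : \bar R := (g (cone_param s) * (cone_weight s)%:E)%E.
have mG : measurable_fun setT G.
  apply: emeasurable_funM; first by apply: measurableT_comp => //; exact: measurable_cone_param.
  by apply/measurable_EFinP; exact: measurable_cone_weight.
have G0 s : (0 <= G s)%E by rewrite mule_ge0// lee_fin cone_weight_ge0.
pose H := (fun z : R * R => g (Q z) * (disc_weight z)%:E)%E \_ disc.
have mH : measurable_fun setT H.
  apply/(measurable_restrictT _ measurable_disc); apply: measurable_funTS.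
  apply: emeasurable_funM; first by apply: measurableT_comp => //; exact: measurable_Q.
  by apply/measurable_EFinP; exact: measurable_disc_weight.
have H0 z : (0 <= H z)%E.
  by apply: erestrict_ge0 => y _; rewrite mule_ge0// lee_fin disc_weight_ge0.
(* [Q], the disc and the weight are all even; this later extends the integral from the upper half
   disc to the whole disc. *)
have HN (u v : R) : H (- u, - v) = H (u, v).
  rewrite /H !patchE.
  have -> : ((- u, - v) \in @disc R) = ((u, v) \in @disc R).
    by apply/idP/idP => /set_mem uv; apply/mem_set; move: uv;
      rewrite /disc/= !sqrrN.
  rewrite /Q /disc_weight/= !sqrrN.
  by rewrite (_ : 2 * - u * - v = 2 * u * v)//; ring.
(* The bound [t <= 1] is moved into the integrand, so that [t] can range over the half-line of
   [ge0_integral_sqr]. *)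
pose L (s : R * R) : \bar R := if s.1 <= 1 then G s else 0%E.
have mL : measurable_fun setT L.
  apply: measurable_fun_ifT => //.
  by apply: measurable_fun_ler => //; exact: measurable_fst.
have L0 s : (0 <= L s)%E by rewrite /L; case: ifP.
(* The disc condition at [(- (v * s), v)] is the cutoff of [L]. The factor 2 is the ratio of the
   constants [(gamma + 1) / pi] and [(gamma + 1) / (2 * pi)]. *)
have HL (v s : R) : 0 < v ->
    H (- (v * s), v) = (2%:E * L (v ^+ 2 * (1 + s ^+ 2), pi + 2 * atan s)%R)%E.
  move=> v0; rewrite /H /L /G patchE -Q_half_angle /cone_weight /disc_weight /=.
  have -> : ((- (v * s), v) \in @disc R) = (v ^+ 2 * (1 + s ^+ 2) <= 1).
    rewrite (_ : v ^+ 2 * (1 + s ^+ 2) = (- (v * s)) ^+ 2 + v ^+ 2); last by ring.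
    by apply/idP/idP => [/set_mem//|uv]; apply/mem_set.
  case: ifPn => _; last by rewrite mule0.
  rewrite muleCA -EFinM; congr (_ * _%:E)%E.
  rewrite (_ : 1 - v ^+ 2 * (1 + s ^+ 2) = 1 - (- (v * s)) ^+ 2 - v ^+ 2); last by ring.
  by move: (@pi R) (@pi_gt0 R) => p p0; field; exact: lt0r_neq0.
have pos (s : R) : 0 < 1 + s ^+ 2 by rewrite ltr_pwDl ?sqr_ge0.
have mpos : measurable (`]0%R, +oo[%classic : set R) by exact: measurable_itv.
have matan2 : measurable_fun setT (fun s : R => pi + 2 * atan s).
  apply: continuous_measurable_fun => x; apply: cvgD; first exact: cvg_cst.
  by apply: cvgM; [exact: cvg_cst|exact: continuous_atan].
have mrat : measurable_fun setT (fun s : R => 2 / (1 + s ^+ 2)).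
  apply: continuous_measurable_fun => x; apply: cvgM; first exact: cvg_cst.
  apply: cvgV; first by rewrite gt_eqF.
  by apply: cvgD; [exact: cvg_cst|exact: exprn_continuous].
have mK1 : measurable_fun setT (fun z : R * R =>
    L (z.1, (pi + 2 * atan z.2)%R) * (2 / (1 + z.2 ^+ 2))%:E)%E.
  apply: emeasurable_funM.
    apply: measurableT_comp => //; apply: measurable_fun_pair => //.
    exact: (measurableT_comp matan2).
  by apply/measurable_EFinP; exact: (measurableT_comp mrat).
have mK2 : measurable_fun setT (fun z : R * R =>
    L (z.1 ^+ 2 * (1 + z.2 ^+ 2), pi + 2 * atan z.2)%R * (4 * z.1)%:E)%E.
  apply: emeasurable_funM.
    apply: measurableT_comp => //; apply: measurable_fun_pair => //.
      apply: measurable_funM; first exact: measurable_funX.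
      by apply: measurable_funD => //; exact: measurable_funX.
    exact: (measurableT_comp matan2).
  by apply/measurable_EFinP; exact: measurable_funM.
(* The null sets [t = 0] and [phi = 0] are dropped, since the substitutions only reach open
   intervals. *)
transitivity (\int[mu]_(t in `]0%R, +oo[)
    \int[mu]_(phi in `]0%R, (2 * pi)%R[) L (t, phi))%E.
  rewrite (@tonelli_rectangle1 _ _ _ _ _ mu mu _ _ G)//.
  rewrite -integral_itv_obnd_cbnd; last first.
    exact: measurable_tonelli_rectangle.
  have -> : `]0%R, 1%R]%classic = `]0%R, +oo[%classic `&` `]-oo, 1%R]%classic :> set R.
    by apply/seteqP; split => x /=; rewrite !in_itv/= andbT => /andP.
  rewrite integral_mkcondr; apply: eq_integral => t _; rewrite patchE.
  have -> : (t \in (`]-oo, 1%R]%classic : set R)) = (t <= 1).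
    by apply/idP/idP => [/set_mem/=|t1]; rewrite ?in_itv//; apply/mem_set; rewrite /= in_itv.
  rewrite /L/=; case: ifPn => _; last by rewrite integral0.
  rewrite -integral_itv_obnd_cbnd//.
  by apply: measurable_funTS; exact: measurableT_comp.
transitivity (\int[mu]_(t in `]0%R, +oo[)
    \int[mu]_s (L (t, (pi + 2 * atan s)%R) * (2 / (1 + s ^+ 2))%:E))%E.
  apply: eq_integral => t _; rewrite ge0_integral_angle//.
  exact: measurableT_comp.
rewrite (@tonelli_rectangle _ _ _ _ _ mu mu (`]0%R, +oo[%classic : set R) setT
  (fun z => L (z.1, (pi + 2 * atan z.2)%R) * (2 / (1 + z.2 ^+ 2))%:E)%E)//;
  last by move=> x y _ _; rewrite mule_ge0 ?L0// lee_fin divr_ge0 ?ltW.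
(* For fixed [s], put [t = v ^+ 2 * (1 + s ^+ 2)]: the product of [2 (1 + s ^+ 2) v] and
   [2 / (1 + s ^+ 2)] is [4 v]. *)
transitivity (\int[mu]_s \int[mu]_(v in `]0%R, +oo[)
    (L (v ^+ 2 * (1 + s ^+ 2), pi + 2 * atan s)%R * (4 * v)%:E))%E.
  apply: eq_integral => s _.
  rewrite (@ge0_integral_sqr _ (1 + s ^+ 2) (fun t => L (t, (pi + 2 * atan s)%R) *
    (2 / (1 + s ^+ 2))%:E)%E)//; last 2 first.
  - by apply: emeasurable_funM => //; exact: measurableT_comp.
  - by move=> y; rewrite mule_ge0 ?L0// lee_fin divr_ge0 ?ltW.
  apply: eq_integral => v _; rewrite -muleA -EFinM; congr (_ * _%:E)%E.
  by field; rewrite gt_eqF.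
rewrite -(@tonelli_rectangle _ _ _ _ _ mu mu (`]0%R, +oo[%classic : set R) setT
  (fun z => L (z.1 ^+ 2 * (1 + z.2 ^+ 2), pi + 2 * atan z.2)%R *
            (4 * z.1)%:E)%E)//; last first.
  move=> x y /=; rewrite in_itv/= andbT => x0 _.
  by rewrite mule_ge0 ?L0// lee_fin mulr_ge0 ?ltW.
(* For fixed [v], put [u = - v s]: by [HL], [4 v L] is [2 v H], and [v ds] becomes [du]. *)
transitivity (\int[mu]_(v in `]0%R, +oo[) (2%:E * \int[mu]_u H (u, v)))%E.
  apply: eq_integral => v; rewrite inE/= in_itv/= andbT => v0.
  rewrite (@ge0_integral_scale _ v (fun u => H (u, v)))//; last first.
    exact: measurableT_comp.
  rewrite -ge0_integralZl//; last 2 first.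
  - apply: emeasurable_funM => //; apply: measurableT_comp => //.
    apply: measurable_fun_pair => //.
    by apply: (measurableT_comp (@oppr_measurable R setT)); exact: measurable_funM.
  - by move=> s _; rewrite mule_ge0 ?H0// lee_fin ltW.
  apply: eq_integral => s _; rewrite HL// muleAC muleA -EFinM muleC.
  by congr (_%:E * _)%E; ring.
rewrite [RHS]integral_mkcond -/H fubini_tonelli2//.
have mJ : measurable_fun setT (fubini_G mu H).
  exact: measurable_fun_fubini_tonelli_G.
have J0 v : (0 <= fubini_G mu H v)%E by exact: integral_ge0.
rewrite ge0_integralZl//; last 2 first.
- by apply: measurable_funTS.
- by move=> v _; exact: J0.
(* Reflecting the inner variable [u] turns the joint symmetry [HN] into evenness in [v] alone. *)
have JN (v : R) : fubini_G mu H (- v) = fubini_G mu H v.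
  have mHv : measurable_fun setT (fun u : R => H (u, - v)).
    by apply: (measurableT_comp mH); exact: measurable_fun_pair.
  apply: (etrans (ge0_integral_oppr mHv (fun u => H0 (u, - v)))).
  by apply: eq_integral => u _; exact: HN.
exact/esym/ge0_integral_even.
Qed.

End cone_to_disc.

(** * The measures of the cone and of the disc *)

Section cone_and_disc_measures.
Context {R : realType}.
Variable gamma : R.
Hypothesis gamma_gt : -1 < gamma.
Local Notation mu := (@lebesgue_measure R).
Local Notation leb2 := (@lebesgue_measure R \x @lebesgue_measure R)%E.
Let S : set (R * R) := `[0%R, 1%R] `*` `[0%R, (2 * pi)%R[.

Let mS : measurable S.
Proof. by apply: measurableX; exact: measurable_itv. Qed.

Lemma disc_measure_measure :
  {nu : {measure set (R * R) -> \bar R} |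
    forall A, nu A = disc_measure gamma A}.
Proof.
have mid : @measurable_fun _ _ (measurableTypeR R * measurableTypeR R)%type
  (R * R)%type setT idfun by exact: measurable_id.
have mw := measurable_funTS (D := @disc R) (measurable_disc_weight gamma).
have [nu nuE] := @weighted_pushforward_measure _ _
  (measurableTypeR R * measurableTypeR R)%type (R * R)%type _ leb2 idfun
  disc (disc_weight gamma) mid measurable_disc mw
  (fun z _ => disc_weight_ge0 gamma_gt z).
by exists nu => A; rewrite nuE.
Qed.

Lemma cone_measure_measure :
  {nu : {measure set (R * R * R) -> \bar R} |
    forall A, nu A = cone_measure gamma A}.
Proof.
have mw := measurable_funTS (D := S) (measurable_cone_weight gamma).
have [nu nuE] := @weighted_pushforward_measure _ _
  (measurableTypeR R * measurableTypeR R)%type (R * R * R)%type _ leb2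
  (@cone_param R)
  S (cone_weight gamma) measurable_cone_param mS mw
  (fun z _ => cone_weight_ge0 gamma_gt z).
by exists nu => A; rewrite nuE.
Qed.

Lemma measurable_cone : measurable (@cone R).
Proof.
have mf : measurable_fun setT
    (fun p : R * R * R => p.1.1 ^+ 2 + p.1.2 ^+ 2 - p.2 ^+ 2).
  have m1 : measurable_fun setT (fun p : R * R * R => p.1.1).
    exact: measurableT_comp.
  have m2 : measurable_fun setT (fun p : R * R * R => p.1.2).
    exact: measurableT_comp.
  apply: measurable_funB; last exact: measurable_funX.
  by apply: measurable_funD; apply: measurable_funX.
have m3 : measurable_fun setT (fun p : R * R * R => p.2).
  exact: measurable_snd.
have -> : @cone R =
    (setT `&` (fun p : R * R * R => p.1.1 ^+ 2 + p.1.2 ^+ 2 - p.2 ^+ 2) @^-1` [set 0])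
    `&` (setT `&` (fun p : R * R * R => p.2) @^-1` `[0, 1]).
  apply/seteqP; split => p; rewrite /cone/= in_itv/=.
    by move=> [/eqP + ->]; rewrite -subr_eq0 => /eqP.
  by move=> [[_ /eqP + [_ ->]]]; rewrite subr_eq0 => /eqP.
apply: measurableI; first by apply: mf.
by apply: m3 => //; exact: measurable_itv.
Qed.

Lemma cone_param_cone s : S s -> cone (cone_param s).
Proof.
move=> [/=]; rewrite in_itv/= => s01 _; split => //=.
by rewrite !exprMn -mulrDr cos2Dsin2 mulr1.
Qed.

Lemma Q_cone z : disc z -> cone (@Q R z).
Proof.
move=> z1; split => /=; first by ring.
by rewrite addr_ge0 ?sqr_ge0//=; exact: z1.
Qed.

Lemma discN z : disc z -> disc (- z : R * R).
Proof. by rewrite /disc/= !sqrrN. Qed.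

Lemma ge0_integral_cone_measure (g : R * R * R -> \bar R) :
  measurable_fun setT g -> (forall p, 0 <= g p)%E ->
  (\int[cone_measure gamma]_(p in cone) g p =
   \int[leb2]_(s in S) (g (cone_param s) * (cone_weight gamma s)%:E))%E.
Proof.
move=> mg g0; have [nu nuE] := cone_measure_measure.
have -> : cone_measure gamma = nu by apply/funext => A; rewrite nuE.
have mw := measurable_funTS (D := S) (measurable_cone_weight gamma).
apply: etrans; first exact: (@ge0_integral_weighted_pushforward _ _
  (measurableTypeR R * measurableTypeR R)%type (R * R * R)%type _ leb2
  (@cone_param R)
  S (cone_weight gamma) measurable_cone_param mS mw
  (fun z _ => cone_weight_ge0 gamma_gt z) nu cone g (fun A _ => nuE A)
  measurable_cone (measurable_funTS mg) (fun p _ => g0 p)).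
congr (integral _ _ _); apply/seteqP; split => s /=; first by case.
by move=> Ss; split => //; exact: cone_param_cone.
Qed.

Lemma ge0_integral_disc_measure (g : R * R -> \bar R) :
  measurable_fun setT g -> (forall z, 0 <= g z)%E ->
  (\int[disc_measure gamma]_(z in disc) g z =
   \int[leb2]_(z in disc) (g z * (disc_weight gamma z)%:E))%E.
Proof.
move=> mg g0; have [nu nuE] := disc_measure_measure.
have -> : disc_measure gamma = nu by apply/funext => A; rewrite nuE.
have mid : @measurable_fun _ _ (measurableTypeR R * measurableTypeR R)%type
  (R * R)%type setT idfun by exact: measurable_id.
have mw := measurable_funTS (D := @disc R) (measurable_disc_weight gamma).
apply: etrans; first exact: (@ge0_integral_weighted_pushforward _ _
  (measurableTypeR R * measurableTypeR R)%type (R * R)%type _ leb2 idfun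
  disc (disc_weight gamma) mid measurable_disc mw
  (fun z _ => disc_weight_ge0 gamma_gt z) nu disc g (fun A _ => nuE A)
  measurable_disc (measurable_funTS mg) (fun z _ => g0 z)).
by congr (integral _ _ _); rewrite preimage_id setIid.
Qed.

Lemma integral_cone_measure_Q (g : R * R * R -> \bar R) :
  measurable_fun setT g ->
  (\int[cone_measure gamma]_(p in cone) g p =
   \int[disc_measure gamma]_(z in disc) g (Q z))%E.
Proof.
move=> mg.
have ge0 h : measurable_fun setT h -> (forall p, 0 <= h p)%E ->
    (\int[cone_measure gamma]_(p in cone) h p =
     \int[disc_measure gamma]_(z in disc) h (Q z))%E.
  move=> mh h0; apply: (etrans (ge0_integral_cone_measure mh h0)).
  have mhQ : measurable_fun setT (fun z => h (Q z)).
    by apply: measurableT_comp => //; exact: measurable_Q.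
  apply: (etrans _ (esym (ge0_integral_disc_measure mhQ (fun z => h0 (Q z))))).
  exact: ge0_integral_cone_disc.
have [nu1 nu1E] := cone_measure_measure.
have [nu2 nu2E] := disc_measure_measure.
have E1 : cone_measure gamma = nu1 by apply/funext => A; rewrite nu1E.
have E2 : disc_measure gamma = nu2 by apply/funext => A; rewrite nu2E.
(* The integral is the difference of the integrals of the positive and negative parts, and both
   parts commute with composition by [Q]. *)
rewrite E1 E2 in ge0 *; rewrite integralE [RHS]integralE.
congr (_ - _)%E.
- apply: etrans; first exact: (ge0 (g^\+)%E (measurable_funepos mg) (funepos_ge0 g)).
  by apply: eq_integral => z _; rewrite !funeposE.
- apply: etrans; first exact: (ge0 (g^\-)%E (measurable_funeneg mg) (funeneg_ge0 g)).
  by apply: eq_integral => z _; rewrite !funenegE.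
Qed.

(** By Tonelli's theorem, the reflection can be done one coordinate at a time. *)
Lemma ge0_integral_leb2N (h : R * R -> \bar R) :
  measurable_fun setT h -> (forall z, 0 <= h z)%E ->
  (\int[leb2]_z h (- (z : R * R))%R = \int[leb2]_z h z)%E.
Proof.
move=> mh h0.
have mN : measurable_fun setT (fun z : R * R => - z).
  by apply: measurable_fun_pair; exact: (measurableT_comp (@oppr_measurable R setT)).
have mhN : measurable_fun setT (fun z : R * R => h (- z)) by exact: measurableT_comp.
rewrite fubini_tonelli2//.
apply: (etrans _ (esym (@fubini_tonelli2 _ _ _ _ _ mu mu h mh h0))).
have mG : measurable_fun setT (fubini_G mu h) by exact: measurable_fun_fubini_tonelli_G.
have G0 y : (0 <= fubini_G mu h y)%E by exact: integral_ge0.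
apply/esym; apply: (etrans (ge0_integral_oppr mG G0)).
apply: eq_integral => v _; rewrite /fubini_G.
have mhv : measurable_fun setT (fun u : R => h (u, - (v : R))).
  by apply: (measurableT_comp mh); exact: measurable_fun_pair.
exact: (ge0_integral_oppr mhv (fun u => h0 (u, - (v : R)))).
Qed.

(** The disc and its weight are even, and planar Lebesgue measure is invariant under the
    reflection. *)
Lemma integral_disc_measureN (g : R * R -> \bar R) :
  measurable_fun setT g ->
  (\int[disc_measure gamma]_(z in disc) g (- (z : R * R))%R =
   \int[disc_measure gamma]_(z in disc) g z)%E.
Proof.
move=> mg.
have mN : measurable_fun setT (fun z : R * R => - z).
  by apply: measurable_fun_pair; exact: (measurableT_comp (@oppr_measurable R setT)).
have ge0 h : measurable_fun setT h -> (forall p, 0 <= h p)%E ->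
    (\int[disc_measure gamma]_(z in disc) h (- (z : R * R))%R =
     \int[disc_measure gamma]_(z in disc) h z)%E.
  move=> mh h0; apply: (etrans _ (esym (ge0_integral_disc_measure mh h0))).
  have mhN : measurable_fun setT (fun z : R * R => h (- z)).
    exact: measurableT_comp.
  apply: (etrans (ge0_integral_disc_measure mhN (fun z => h0 (- z)))).
  pose k := (fun z : R * R => h z * (disc_weight gamma z)%:E)%E \_ disc.
  have mk : measurable_fun setT k.
    apply/(measurable_restrictT _ measurable_disc); apply: measurable_funTS.
    apply: emeasurable_funM => //.
    by apply/measurable_EFinP; exact: measurable_disc_weight.
  have k0 z : (0 <= k z)%E.
    by apply: erestrict_ge0 => y _; rewrite mule_ge0// lee_fin disc_weight_ge0.
  rewrite integral_mkcond [RHS]integral_mkcond -/k.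
  apply: (etrans _ (ge0_integral_leb2N mk k0)).
  apply: eq_integral => z _; rewrite /k !patchE.
  have -> : (- (z : R * R) \in @disc R) = (z \in @disc R).
    by apply/idP/idP => /set_mem uv; apply/mem_set; move: uv;
      rewrite /disc/= !sqrrN.
  by rewrite /disc_weight/= !sqrrN.
have [nu2 nu2E] := disc_measure_measure.
have E2 : disc_measure gamma = nu2 by apply/funext => A; rewrite nu2E.
rewrite E2 in ge0 *; rewrite integralE [RHS]integralE.
congr (_ - _)%E.
- apply: etrans; last exact: (ge0 (g^\+)%E (measurable_funepos mg) (funepos_ge0 g)).
  by apply: eq_integral => z _; rewrite !funeposE.
- apply: etrans; last exact: (ge0 (g^\-)%E (measurable_funeneg mg) (funeneg_ge0 g)).
  by apply: eq_integral => z _; rewrite !funenegE.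
Qed.

(** With [t = 1 - exp(- s)] the integrand becomes [exp(- (gamma + 1) s)], a multiple of the
    exponential density of rate [gamma + 1]. The rate is positive because [-1 < gamma]. *)
Lemma integral_onem_powR :
  (\int[mu]_(t in `[0%R, 1%R]) ((1 - t) `^ gamma)%:E < +oo)%E.
Proof.
have c0 : 0 < gamma + 1 by move: gamma_gt; lra.
have mw : measurable_fun setT (fun t : R => ((1 - t) `^ gamma)%:E).
  apply/measurable_EFinP; apply: (measurableT_comp (measurable_powR gamma)).
  exact: measurable_funB.
rewrite -integral_itv_bndo_bndc; last exact: measurable_funTS.
(* The substitution covers all of []-oo, 1[]; [h] vanishes below 0, which matches the exponential
   density vanishing for [s < 0]. *)
pose h (t : R) : \bar R := if 0 <= t then ((1 - t) `^ gamma)%:E else 0%E.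
have mh : measurable_fun setT h.
  by apply: measurable_fun_ifT => //; exact: measurable_fun_ler.
have -> : (\int[mu]_(t in `[0%R, 1%R[) ((1 - t) `^ gamma)%:E =
    \int[mu]_(t in `]-oo, 1%R[) h t)%E.
  have -> : `[0%R, 1%R[%classic = `]-oo, 1%R[%classic `&` `[0%R, +oo[%classic :> set R.
    by apply/seteqP; split => x /=; rewrite !in_itv/= andbT andbC => /andP.
  rewrite integral_mkcondr; apply: eq_integral => t _; rewrite patchE /h.
  have -> // : (t \in (`[0%R, +oo[%classic : set R)) = (0 <= t).
  by apply/idP/idP => [/set_mem/=|t1]; rewrite ?in_itv/= ?andbT//;
    apply/mem_set; rewrite /= in_itv/= andbT.
have dF (s : R) : is_derive s 1 (fun s : R => 1 - expR (- s)) (expR (- s)).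
  by apply: is_derive_eq; rewrite /GRing.scale/=; ring.
rewrite (@ge0_change_of_variables _ (fun s => 1 - expR (- s))
  (fun y => - ln (1 - y)) (fun s => expR (- s)) (`]-oo, 1[ : set R) h
  _ _ _ _ _ _ dF)//.
- rewrite (_ : (fun x => _) = fun s => ((gamma + 1)^-1%:E *
      (exponential_pdf (gamma + 1) s)%:E)%E); last first.
    apply/funext => s; rewrite /h.
    have -> : (0 <= 1 - expR (- s)) = (0 <= s).
      by rewrite subr_ge0 -expR0 ler_expR oppr_le0.
    case: ifPn => s0; last first.
      by rewrite mul0e lt0_exponential_pdf ?mule0// ltNge.
    rewrite exponential_pdfE// -!EFinM; congr EFin.
    rewrite opprB addrC subrK mulKf ?gt_eqF//.
    rewrite /powR gt_eqF ?expR_gt0// expRK -expRD; congr (expR _); ring.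
  rewrite ge0_integralZl//.
  + by rewrite integral_exponential_pdf// mule1 ltry.
  + by apply/measurable_EFinP; exact: measurable_exponential_pdf.
  + by move=> s _; rewrite lee_fin exponential_pdf_ge0// ltW.
  + by rewrite lee_fin invr_ge0 ltW.
- exact: interval_is_interval.
- by move=> x /=; rewrite in_itv/= ltrBlDr ltrDl expR_gt0.
- by move=> x; rewrite opprB addrC subrK expRK opprK.
- move=> y /=; rewrite in_itv/= opprK => y1.
  by rewrite lnK ?posrE ?subr_gt0// opprB addrC subrK.
- apply: (measurableT_comp (@oppr_measurable R setT)).
  by apply: (measurableT_comp (@measurable_ln R)); exact: measurable_funB.
- by move=> x y xy; rewrite ltrD2l ltrN2 ltr_expR ltrN2.
- move=> x; apply: (@continuous_comp _ _ _ -%R (@expR R)).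
    exact: opp_continuous.
  exact: continuous_expR.
- exact: measurable_funTS.
- by move=> y _; rewrite /h; case: ifP => // _; rewrite lee_fin powR_ge0.
Qed.

(** Finite mass makes bounded measurable functions integrable. By Tonelli's theorem the mass is a
    radial integral times the length of the angular interval. *)
Lemma cone_measure_fin : (cone_measure gamma cone < +oo)%E.
Proof.
have [nu nuE] := cone_measure_measure.
have mC := measurable_cone.
have -> : (cone_measure gamma cone = \int[cone_measure gamma]_(p in cone) 1%:E)%E.
  have -> : cone_measure gamma = nu by apply/funext => A; rewrite nuE.
  by rewrite integral_cst// mul1e.
rewrite ge0_integral_cone_measure//.
under eq_integral do rewrite mul1e.
have mw : measurable_fun setT (fun s => (cone_weight gamma s)%:E).
  by apply/measurable_EFinP; exact: measurable_cone_weight.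
rewrite (@tonelli_rectangle2 _ _ _ _ _ mu mu _ _ (fun s => (cone_weight gamma s)%:E))//;
  last by move=> *; rewrite lee_fin cone_weight_ge0.
have c0 : 0 <= (gamma + 1) / (2 * pi).
  rewrite divr_ge0 ?mulr_ge0 ?pi_ge0//.
  by move: gamma_gt; lra.
set I := (\int[mu]_(t in `[0%R, 1%R]) ((1 - t) `^ gamma)%:E)%E.
have I0 : (0 <= I)%E by apply: integral_ge0 => t _; rewrite lee_fin powR_ge0.
have Ifin : I \is a fin_num by rewrite ge0_fin_numE// integral_onem_powR.
have IE (y : R) : (\int[mu]_(t in `[0%R, 1%R]) (cone_weight gamma (t, y))%:E =
    ((gamma + 1) / (2 * pi))%:E * I)%E.
  rewrite -ge0_integralZl//.
  - apply: measurable_funTS; apply/measurable_EFinP.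
    apply: (measurableT_comp (measurable_powR gamma)).
    exact: measurable_funB.
  - by move=> t _; rewrite lee_fin powR_ge0.
under eq_integral do rewrite IE.
rewrite integral_cst//= lebesgue_measure_itv/=.
case: ifP => _; last by rewrite mule0 ltry.
by rewrite ?sube0 -(fineK Ifin) -!EFinM ltry.
Qed.

(** Transporting the constant 1 along [Q] shows that the disc and the cone have the same mass. *)
Lemma disc_measure_fin : (disc_measure gamma disc < +oo)%E.
Proof.
have [nu1 nu1E] := cone_measure_measure.
have [nu2 nu2E] := disc_measure_measure.
have E1 : cone_measure gamma = nu1 by apply/funext => A; rewrite nu1E.
have E2 : disc_measure gamma = nu2 by apply/funext => A; rewrite nu2E.
have := @integral_cone_measure_Q (fun=> 1%E) (measurable_cst _).
have := cone_measure_fin; rewrite E1 E2.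
rewrite !integral_cst ?mul1e//; [|exact: measurable_disc|exact: measurable_cone].
by move=> + <-.
Qed.

End cone_and_disc_measures.

(** * Polynomial functions *)

(* Imported only here because [mpoly] redefines [isMeasure]. *)
Import -(notations) mpoly.

Section polynomial_functions.
Context {R : realType} {d : measure_display} {T : measurableType d}.
Variables (r : nat) (coord : T -> 'I_r -> R) (D : set T).
Implicit Types (f g : T -> R[i]) (m : nat).
Local Notation polyf m := (poly_space coord D m).

Lemma poly_space_eq m f g :
  (forall x, D x -> f x = g x) -> polyf m f -> polyf m g.
Proof. by move=> fg [p pm fE]; exists p => // x Dx; rewrite -fg// fE. Qed.

Lemma poly_space_le m m' f : (m <= m')%N -> polyf m f -> polyf m' f.
Proof. by move=> mm' [p pm fE]; exists p => //; exact: (leq_trans pm). Qed.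

Lemma poly_space_cst (c : R[i]) : polyf 0 (fun=> c).
Proof.
exists (mpolyC r c); last by move=> x _; rewrite mevalC.
by rewrite msizeC; case: (c == 0).
Qed.

Lemma poly_space_coord i : polyf 1 (fun x => (coord x i)%:C%C).
Proof.
exists (mpolyX _ (mnm1 i)); last by move=> x _; rewrite mevalXU.
by rewrite msizeX mdeg1.
Qed.

Lemma poly_spaceD m f g : polyf m f -> polyf m g -> polyf m (fun x => f x + g x).
Proof.
move=> [p pm fE] [q qm gE]; exists (p + q).
  by rewrite (leq_trans (msizeD_le _ _))// geq_max pm.
by move=> x Dx; rewrite mevalD fE// gE.
Qed.

Lemma poly_spaceM m m' f g :
  polyf m f -> polyf m' g -> polyf (m + m') (fun x => f x * g x).
Proof.
move=> [p pm fE] [q qm gE]; exists (p * q); last first.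
  by move=> x Dx; rewrite mevalM fE// gE.
(* [msize] is the degree plus one but 0 at the zero polynomial, so the product formula [msizeM]
   concerns nonzero factors. *)
have [->|p0] := eqVneq p 0; first by rewrite mul0r msize0.
have [->|q0] := eqVneq q 0; first by rewrite mulr0 msize0.
rewrite msizeM//; apply: (@leq_trans (m.+1 + m'.+1).-1).
  by rewrite -!subn1 leq_sub2r// leq_add.
by rewrite addnS/= addSn.
Qed.

Lemma poly_spaceZ m (c : R[i]) f : polyf m f -> polyf m (fun x => c * f x).
Proof. by move=> fm; have := poly_spaceM (poly_space_cst c) fm. Qed.

(** The condition is restricted to members of [s] so that [s] can be the support of a polynomial,
    where the degrees of monomials are bounded. *)
Lemma poly_space_sum m (I : eqType) (s : seq I) (F : I -> T -> R[i]) :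
  (forall i, i \in s -> polyf m (F i)) -> polyf m (fun x => \sum_(i <- s) F i x).
Proof.
elim: s => [|i s IHs] Fm.
  apply: (poly_space_eq _ (poly_space_le (leq0n m) (poly_space_cst 0))) => x _.
  by rewrite big_nil.
apply: (@poly_space_eq m (fun x => F i x + \sum_(j <- s) F j x)).
  by move=> x _; rewrite big_cons.
apply: poly_spaceD; first by apply: Fm; rewrite mem_head.
by apply: IHs => j js; apply: Fm; rewrite in_cons js orbT.
Qed.

Lemma poly_spaceX m f k : polyf m f -> polyf (k * m) (fun x => f x ^+ k).
Proof.
move=> fm; elim: k => [|k IHk]; first exact: poly_space_cst.
apply: (@poly_space_eq _ (fun x => f x * f x ^+ k)).
  by move=> x _; rewrite exprS.
by rewrite mulSn; exact: poly_spaceM.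
Qed.

Lemma poly_space_prod (I : Type) (s : seq I) (F : I -> T -> R[i]) (k : I -> nat) :
  (forall i, polyf (k i) (F i)) ->
  polyf (\sum_(i <- s) k i) (fun x => \prod_(i <- s) F i x).
Proof.
move=> Fk; elim: s => [|i s IHs].
  rewrite big_nil; apply: (poly_space_eq _ (poly_space_cst 1)) => x _.
  by rewrite big_nil.
rewrite big_cons; apply: (@poly_space_eq _ (fun x => F i x * \prod_(j <- s) F j x)).
  by move=> x _; rewrite big_cons.
exact: poly_spaceM.
Qed.

End polynomial_functions.

(** * Polynomials on the cone as even polynomials on the disc *)

Section pullback.
Context {R : realType}.

Lemma disc_coord0 (z : R * R) : disc_coord z 0 = z.1. Proof. by []. Qed.
Lemma disc_coord1 (z : R * R) : disc_coord z 1 = z.2. Proof. by []. Qed.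

(** The coordinates of [Q] are quadratic, so a monomial of degree [k] pulls back to degree [2 k]. *)
Lemma poly_space_comp_Q n (f : R * R * R -> R[i]) :
  poly_space (@cone_coord R) (@cone R) n f ->
  poly_space (@disc_coord R) (@disc R) (2 * n) (f \o Q (R := R)).
Proof.
move=> [p pn fE].
apply: (@poly_space_eq _ _ _ _ _ _ _ (fun z => \sum_(m <- msupp p)
    mcoeff m p * \prod_i (cone_coord (Q z) i)%:C%C ^+ m i)).
  by move=> z /Q_cone Qz; rewrite /= fE// mevalE.
have c1 : poly_space (@disc_coord R) (@disc R) 1 (fun z => z.1%:C%C).
  exact: (poly_space_coord _ _ 0).
have c2 : poly_space (@disc_coord R) (@disc R) 1 (fun z => z.2%:C%C).
  exact: (poly_space_coord _ _ 1).
have cQ i : poly_space (@disc_coord R) (@disc R) 2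
    (fun z => (cone_coord (Q z) i)%:C%C).
  case: i => -[|[|[|//]]] i3 /=.
  - apply: (poly_space_eq _ (poly_spaceD (poly_spaceM c1 c1)
      (poly_spaceZ (-1) (poly_spaceM c2 c2)))) => z _.
    rewrite (_ : cone_coord _ _ = z.1 ^+ 2 - z.2 ^+ 2)//.
    by rewrite rmorphB !rmorphXn/= mulN1r !expr2.
  - apply: (poly_space_eq _ (poly_spaceZ 2%:C%C (poly_spaceM c1 c2))) => z _.
    rewrite (_ : cone_coord _ _ = 2 * z.1 * z.2)//.
    by rewrite !rmorphM/= mulrA.
  - apply: (poly_space_eq _ (poly_spaceD (poly_spaceM c1 c1)
      (poly_spaceM c2 c2))) => z _.
    rewrite (_ : cone_coord _ _ = z.1 ^+ 2 + z.2 ^+ 2)//.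
    by rewrite rmorphD !rmorphXn/= !expr2.
apply: poly_space_sum => m mp; apply: poly_spaceZ.
apply: (@poly_space_le _ _ _ _ _ _ (2 * mdeg m)).
  by rewrite leq_mul2l/=; have := msize_mdeg_lt mp; move=> /leq_trans/(_ pn).
rewrite mdegE big_distrr/=.
apply: poly_space_prod => i; rewrite mulnC; exact: poly_spaceX.
Qed.

(** Averaging keeps the monomials [u^a v^b] with [a + b] even. Then [a] and [b] have the same
    parity, and the monomial is a product of powers of [u^2], [v^2] and at most one factor [u v],
    each linear in [Q(u, v)]. *)
Lemma even_poly_space n (f : R * R -> R[i]) :
  poly_space (@disc_coord R) (@disc R) (2 * n) f ->
  exists2 g, poly_space (@cone_coord R) (@cone R) n g &
    forall z, disc z -> 2^-1 * (f z + f (- (z : R * R))) = g (Q z).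
Proof.
move=> [p pn fE].
have c0 : poly_space (@cone_coord R) (@cone R) 1 (fun q => q.1.1%:C%C).
  exact: (poly_space_coord _ _ 0).
have c1 : poly_space (@cone_coord R) (@cone R) 1 (fun q => q.1.2%:C%C).
  exact: (poly_space_coord _ _ 1).
have c2 : poly_space (@cone_coord R) (@cone R) 1 (fun q => q.2%:C%C).
  exact: (poly_space_coord _ _ 2).
pose G (m : 'I_2 -> nat) (q : R * R * R) : R[i] :=
  if odd (m 0%R + m 1%R) then 0 else
  ((2^-1 * (q.1.1 + q.2)) ^+ (m 0%R)./2 * (2^-1 * (q.2 - q.1.1)) ^+ (m 1%R)./2 *
    (2^-1 * q.1.2) ^+ odd (m 0%R))%:C%C.
exists (fun q => \sum_(m <- msupp p) mcoeff m p * G m q).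
  apply: poly_space_sum => m mp; apply: poly_spaceZ; rewrite /G.
  have [_|modd] := boolP (odd (m 0%R + m 1%R)).
    exact: (poly_space_le (leq0n n) (poly_space_cst _ _ 0)).
  (* For exponents [a], [b] of equal parity, the rounded halves plus the common parity bit add up to
     [(a + b) / 2]. *)
  have half : ((m 0%R)./2 * 1 + (m 1%R)./2 * 1 + odd (m 0%R) * 1 <= n)%N.
    have := leq_trans (msize_mdeg_lt mp) pn.
    rewrite mdegE big_ord_recl big_ord1 /= ltnS.
    have -> : lift ord0 ord0 = 1 :> 'I_2 by apply/val_inj.
    have -> : ord0 = 0 :> 'I_2 by apply/val_inj.
    move: modd; move: (m 0%R) (m 1%R) => a b; rewrite !muln1.
    rewrite -{2}(odd_double_half a) -{2}(odd_double_half b) oddD.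
    by case: (odd a) (odd b) => -[]//= _; lia.
  apply: (poly_space_le half).
  apply: (poly_space_eq _ (poly_spaceM (poly_spaceM
    (poly_spaceX (m 0%R)./2 (poly_spaceZ (2^-1)%:C%C (poly_spaceD c0 c2)))
    (poly_spaceX (m 1%R)./2 (poly_spaceZ (2^-1)%:C%C
       (poly_spaceD c2 (poly_spaceZ (-1) c0)))))
    (poly_spaceX (odd (m 0%R)) (poly_spaceZ (2^-1)%:C%C c1)))) => q _.
  by rewrite !(rmorphM, rmorphXn, rmorphD, rmorphN)/= mulN1r.
move=> z Dz; rewrite !fE//; last exact: discN.
rewrite !mevalE -big_split/= mulr_sumr; apply: eq_bigr => m _.
rewrite -mulrDr mulrCA; congr (_ * _).
rewrite !big_ord_recl !big_ord0 !mulr1.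
have -> : lift ord0 ord0 = 1 :> 'I_2 by apply/val_inj.
have -> : ord0 = 0 :> 'I_2 by apply/val_inj.
rewrite !disc_coord0 !disc_coord1 /G /=.
move: (m 0%R) (m 1%R) => a b.
rewrite -!(rmorphXn (real_complex R)) -!(rmorphM (real_complex R)) -(rmorphD (real_complex R)).
rewrite (_ : 2^-1 = (2^-1)%:C%C :> R[i]); last first.
  by rewrite fmorphV rmorph_nat.
rewrite -(rmorphM (real_complex R)).
(* The reflection multiplies the monomial by [(-1)^(a + b)]. *)
have -> : 2^-1 * (z.1 ^+ a * z.2 ^+ b + (- z.1) ^+ a * (- z.2) ^+ b) =
    if odd (a + b) then 0 else z.1 ^+ a * z.2 ^+ b.
  rewrite (exprNn z.1) (exprNn z.2) mulrACA -exprD -signr_odd.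
  case: (odd (a + b)); first by rewrite expr1 mulN1r subrr mulr0.
  by rewrite expr0 mul1r; field.
case: ifPn => // abodd; congr (_%:C%C).
have -> : 2^-1 * (z.1 ^+ 2 - z.2 ^+ 2 + (z.1 ^+ 2 + z.2 ^+ 2)) = z.1 ^+ 2.
  by field.
have -> : 2^-1 * (z.1 ^+ 2 + z.2 ^+ 2 - (z.1 ^+ 2 - z.2 ^+ 2)) = z.2 ^+ 2.
  by field.
have -> : 2^-1 * (2 * z.1 * z.2) = z.1 * z.2 by field.
rewrite -!exprM !mul2n exprMn mulrACA -!exprD.
rewrite [(_ + odd a)%N]addnC odd_double_half.
(* The exponent of [z.2] is twice [b./2] plus [odd a]; equal parity makes it [b]. *)
have -> : odd a = odd b :> nat by move: abodd; rewrite oddD; do 2!case: odd.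
by rewrite [(_ + odd b)%N]addnC odd_double_half.
Qed.

End pullback.

(** * The inner products *)

Section complex_integral.
Context {R : realType} {d : measure_display} {T : measurableType d}.
Variables (mu : {measure set T -> \bar R}) (D : set T).
Hypotheses (mD : measurable D) (muD : (mu D < +oo)%E).
Implicit Types f g : T -> R[i].

(** A class closed under sums, products and conjugation, whose members are integrable on [D] because
    [D] has finite mass. *)
Definition tame f := [/\ measurable_fun setT (fun x => complex.Re (f x)),
  measurable_fun setT (fun x => complex.Im (f x)) &
  exists M : R, forall x, D x ->
    `|complex.Re (f x)| <= M /\ `|complex.Im (f x)| <= M].

Lemma ReM (a b : R[i]) : complex.Re (a * b) =
  complex.Re a * complex.Re b - complex.Im a * complex.Im b.
Proof. by case: a; case: b. Qed.

Lemma ImM (a b : R[i]) : complex.Im (a * b) =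
  complex.Re a * complex.Im b + complex.Im a * complex.Re b.
Proof. by case: a; case: b. Qed.

Lemma ReD (a b : R[i]) : complex.Re (a + b) = complex.Re a + complex.Re b.
Proof. by case: a; case: b. Qed.

Lemma ImD (a b : R[i]) : complex.Im (a + b) = complex.Im a + complex.Im b.
Proof. by case: a; case: b. Qed.

Lemma ReJ (a : R[i]) : complex.Re a^* = complex.Re a.
Proof. by case: a. Qed.

Lemma ImJ (a : R[i]) : complex.Im a^* = - complex.Im a.
Proof. by case: a. Qed.

Lemma complex_inj (a b : R[i]) :
  complex.Re a = complex.Re b -> complex.Im a = complex.Im b -> a = b.
Proof. by case: a => x y; case: b => x' y' /= -> ->. Qed.

Lemma tame_cst (c : R[i]) : tame (fun=> c).
Proof.
split; [exact: measurable_cst|exact: measurable_cst|].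
exists (Num.max `|complex.Re c| `|complex.Im c|) => x _.
by rewrite !le_max !lexx orbT.
Qed.

Lemma tame_real (f : T -> R) (M : R) : measurable_fun setT f ->
  (forall x, D x -> `|f x| <= M) -> tame (fun x => (f x)%:C%C).
Proof.
move=> mf fM; split => /=; [exact: mf|exact: measurable_cst|].
by exists M => x Dx; rewrite normr0 fM//; split => //; exact: le_trans (fM x Dx).
Qed.

Lemma tame_conj f : tame f -> tame (fun x => (f x)^*).
Proof.
move=> [mr mi [M fM]]; split.
- by under eq_fun do rewrite ReJ.
- under eq_fun do rewrite ImJ.
  exact: (measurableT_comp (@oppr_measurable R setT)).
- by exists M => x /fM; rewrite ReJ ImJ normrN.
Qed.

Lemma tameD f g : tame f -> tame g -> tame (fun x => f x + g x).
Proof.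
move=> [fr fi [M fM]] [gr gi [N gN]]; split.
- by under eq_fun do rewrite ReD; exact: measurable_funD.
- by under eq_fun do rewrite ImD; exact: measurable_funD.
- exists (M + N) => x Dx; have [? ?] := fM x Dx; have [? ?] := gN x Dx.
  by rewrite ReD ImD; split; rewrite (le_trans (ler_normD _ _))// lerD.
Qed.

Lemma tameM f g : tame f -> tame g -> tame (fun x => f x * g x).
Proof.
move=> [fr fi [M fM]] [gr gi [N gN]]; split.
- under eq_fun do rewrite ReM.
  by apply: measurable_funB; exact: measurable_funM.
- under eq_fun do rewrite ImM.
  by apply: measurable_funD; exact: measurable_funM.
- exists (M * N + M * N) => x Dx; have [? ?] := fM x Dx; have [? ?] := gN x Dx.
  rewrite ReM ImM; split; [apply: (le_trans (ler_normB _ _))|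
    apply: (le_trans (ler_normD _ _))]; rewrite !normrM;
  by apply: lerD; apply: ler_pM.
Qed.

Lemma tame_sum (I : Type) (s : seq I) (F : I -> T -> R[i]) :
  (forall i, tame (F i)) -> tame (fun x => \sum_(i <- s) F i x).
Proof.
move=> tF; elim: s => [|i s IHs].
  by under eq_fun do rewrite big_nil; exact: tame_cst.
by under eq_fun do rewrite big_cons; exact: tameD.
Qed.

Lemma tame_prod (I : Type) (s : seq I) (F : I -> T -> R[i]) :
  (forall i, tame (F i)) -> tame (fun x => \prod_(i <- s) F i x).
Proof.
move=> tF; elim: s => [|i s IHs].
  by under eq_fun do rewrite big_nil; exact: tame_cst.
by under eq_fun do rewrite big_cons; exact: tameM.
Qed.

Lemma tameX f k : tame f -> tame (fun x => f x ^+ k).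
Proof.
move=> tf; elim: k => [|k IHk]; first exact: tame_cst.
by under eq_fun do rewrite exprS; exact: tameM.
Qed.

Lemma tame_meval r (coord : T -> 'I_r -> R) (p : mpoly r R[i]) :
  (forall i, tame (fun x => (coord x i)%:C%C)) ->
  tame (fun x => meval (fun i => (coord x i)%:C%C) p).
Proof.
move=> tc; under eq_fun do rewrite mevalE.
apply: tame_sum => m; apply: tameM; first exact: tame_cst.
by apply: tame_prod => i; exact: tameX.
Qed.

Lemma bounded_measurable_integrable (h : T -> R) (M : R) :
  measurable_fun setT h -> (forall x, D x -> `|h x| <= M) ->
  mu.-integrable D (EFin \o h).
Proof.
move=> mh hM; apply: measurable_bounded_integrable => //.
  exact: measurable_funTS.
exists M; split; first exact: num_real.
by move=> y My x Dx /=; rewrite (le_trans (hM x Dx))// ltW.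
Qed.

Lemma tame_integrableRe f : tame f ->
  mu.-integrable D (EFin \o (fun x => complex.Re (f x))).
Proof.
move=> [fr fi [M fM]]; apply: (@bounded_measurable_integrable _ M) => // x Dx.
by have [] := fM x Dx.
Qed.

Lemma tame_integrableIm f : tame f ->
  mu.-integrable D (EFin \o (fun x => complex.Im (f x))).
Proof.
move=> [fr fi [M fM]]; apply: (@bounded_measurable_integrable _ M) => // x Dx.
by have [] := fM x Dx.
Qed.

Lemma eq_cintegral f g :
  (forall x, D x -> f x = g x) -> cintegral mu D f = cintegral mu D g.
Proof.
move=> fg; apply: complex_inj => /=; congr fine; apply: eq_integral => x;
  by rewrite inE => Dx; rewrite fg.
Qed.

Lemma cintegralD f g : tame f -> tame g ->
  cintegral mu D (fun x => f x + g x) = cintegral mu D f + cintegral mu D g.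
Proof.
move=> tf tg; apply: complex_inj; rewrite ?ReD ?ImD /=.
- under eq_integral do rewrite ReD.
  by rewrite -[LHS]/(Rintegral _ _ _) RintegralD//; exact: tame_integrableRe.
- under eq_integral do rewrite ImD.
  by rewrite -[LHS]/(Rintegral _ _ _) RintegralD//; exact: tame_integrableIm.
Qed.

Lemma cintegralZ (c : R[i]) f : tame f ->
  cintegral mu D (fun x => c * f x) = c * cintegral mu D f.
Proof.
move=> tf; have iR := tame_integrableRe tf; have iI := tame_integrableIm tf.
have iZR k : mu.-integrable D (EFin \o (fun x => k * complex.Re (f x))).
  by apply: (eq_integrable _ (fun x => k%:E * (complex.Re (f x))%:E)%E) => //;
    exact: integrableZl.
have iZI k : mu.-integrable D (EFin \o (fun x => k * complex.Im (f x))).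
  by apply: (eq_integrable _ (fun x => k%:E * (complex.Im (f x))%:E)%E) => //;
    exact: integrableZl.
apply: complex_inj; rewrite ?ReM ?ImM /=.
- under eq_integral do rewrite ReM.
  by rewrite -[LHS]/(Rintegral _ _ _) RintegralB// !RintegralZl.
- under eq_integral do rewrite ImM.
  by rewrite -[LHS]/(Rintegral _ _ _) RintegralD// !RintegralZl.
Qed.

Lemma cintegral_conj f : tame f ->
  cintegral mu D (fun x => (f x)^*) = (cintegral mu D f)^*.
Proof.
move=> tf; apply: complex_inj; rewrite ?ReJ ?ImJ /=.
- by under eq_integral do rewrite ReJ.
- under eq_integral do rewrite ImJ -mulN1r.
  rewrite -[LHS]/(Rintegral _ _ _) RintegralZl// ?mulN1r//.
  exact: tame_integrableIm.
Qed.

Lemma cintegral_sum (I : Type) (s : seq I) (c : I -> R[i]) (F : I -> T -> R[i]) :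
  (forall i, tame (F i)) ->
  cintegral mu D (fun x => \sum_(i <- s) c i * F i x) =
  \sum_(i <- s) c i * cintegral mu D (F i).
Proof.
move=> tF; elim: s => [|i s IHs].
  rewrite big_nil; under eq_fun do rewrite big_nil.
  by apply: complex_inj => /=; rewrite integral0.
rewrite big_cons -IHs -cintegralZ// -cintegralD//.
- by congr (cintegral _ _); apply/funext => x; rewrite big_cons.
- by apply: tameM => //; exact: tame_cst.
- by apply: tame_sum => j; apply: tameM => //; exact: tame_cst.
Qed.

End complex_integral.

(** * Inner products and orthonormal expansions *)

Section inner_product.
Context {R : realType} {d : measure_display} {T : measurableType d}.
Variables (mu : {measure set T -> \bar R}) (D : set T).
Hypotheses (mD : measurable D) (muD : (mu D < +oo)%E).
Implicit Types f g : T -> R[i].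

(** Elements of [poly_space] are arbitrary outside [D], hence possibly not measurable there; a tame
    representative takes their place in integrals. *)
Definition tame_on f := exists2 g, tame D g & forall x, D x -> f x = g x.

Lemma eq_inner f f' g g' : (forall x, D x -> f x = f' x) ->
  (forall x, D x -> g x = g' x) -> inner mu D f g = inner mu D f' g'.
Proof. by move=> ff gg; apply: eq_cintegral => x Dx; rewrite ff// gg. Qed.

Lemma innerC f g : tame_on f -> tame_on g -> inner mu D g f = (inner mu D f g)^*.
Proof.
move=> [f' tf ff] [g' tg gg]; rewrite (eq_inner ff gg) (eq_inner gg ff).
rewrite -cintegral_conj//; last by apply: tameM => //; exact: tame_conj.
by apply: eq_cintegral => x _; rewrite rmorphM/= conjCK mulrC.
Qed.

Lemma inner_suml N (c : 'I_N -> R[i]) (F : 'I_N -> T -> R[i]) g :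
  (forall i, tame_on (F i)) -> tame_on g ->
  inner mu D (fun x => \sum_(i < N) c i * F i x) g =
  \sum_(i < N) c i * inner mu D (F i) g.
Proof.
move=> tF [g' tg gg].
have /choice[F' F'P] i : exists f', tame D f' /\ forall x, D x -> F i x = f' x.
  by have [f' ? ?] := tF i; exists f'.
have tF' i : tame D (fun x => F' i x * (g' x)^*).
  by apply: tameM; [have [] := F'P i|exact: tame_conj].
under [RHS]eq_bigr do rewrite (eq_inner (F'P _).2 gg).
rewrite -cintegral_sum//; apply: eq_cintegral => x Dx.
rewrite gg// mulr_suml; apply: eq_bigr => i _.
by have [_ ->//] := F'P i; rewrite mulrA.
Qed.

(** Pairing any expansion of [f] with [P l] leaves its [l]-th coefficient. *)
Lemma orthonormal_expansion (E : set (T -> R[i])) N (P : 'I_N -> T -> R[i]) f :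
  orthonormal_basis mu D E P -> (forall f, E f -> tame_on f) -> E f ->
  forall x, D x -> f x = \sum_(l < N) inner mu D f (P l) * P l x.
Proof.
move=> [EP oP sP] tE Ef; have [c fc] := sP f Ef.
suff cE l : inner mu D f (P l) = c l.
  by move=> x Dx; rewrite fc//; apply: eq_bigr => l _; rewrite cE.
have tP k : tame_on (P k) by exact/tE/EP.
rewrite (eq_inner fc (fun _ _ => erefl)) inner_suml//.
rewrite (bigD1 l)//= oP eqxx mulr1 big1 ?addr0// => k kl.
by rewrite oP (negbTE kl) mulr0.
Qed.

Lemma poly_space_tame_on r (coord : T -> 'I_r -> R) (M : R) m f :
  (forall i, measurable_fun setT (fun x => coord x i)) ->
  (forall i x, D x -> `|coord x i| <= M) ->
  poly_space coord D m f -> tame_on f.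
Proof.
move=> mc cM [p _ fE]; exists (fun x => meval (fun i => (coord x i)%:C%C) p) => //.
by apply: tame_meval => i; apply: (tame_real (M := M)) => // x; exact: cM.
Qed.

End inner_product.

(** * The isometry given by [Q] and the invariance under reflection *)

Section cone_disc_inner.
Context {R : realType}.
Variable gamma : R.
Hypothesis gamma_gt : -1 < gamma.

Lemma measurable_disc_coord i : measurable_fun setT (fun z : R * R => disc_coord z i).
Proof.
by case: i => -[|[|//]] i2; [exact: measurable_fst|exact: measurable_snd].
Qed.

Lemma measurable_cone_coord i :
  measurable_fun setT (fun p : R * R * R => cone_coord p i).
Proof.
case: i => -[|[|[|//]]] i3.
- exact: (measurableT_comp measurable_fst measurable_fst).
- exact: (measurableT_comp measurable_snd measurable_fst).
- exact: measurable_snd.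
Qed.

Lemma disc_coord_le1 i (z : R * R) : disc z -> `|disc_coord z i| <= 1.
Proof.
move=> z1; have z1' : z.1 ^+ 2 + z.2 ^+ 2 <= 1 by [].
rewrite -(ler_pXn2r (n := 2)) ?nnegrE// expr1n real_normK ?num_real//.
case: i => -[|[|//]] i2 /=; apply: le_trans z1'.
- by rewrite (_ : disc_coord _ _ = z.1)// lerDl sqr_ge0.
- by rewrite (_ : disc_coord _ _ = z.2)// lerDr sqr_ge0.
Qed.

Lemma cone_coord_le1 i (p : R * R * R) : cone p -> `|cone_coord p i| <= 1.
Proof.
move=> [pE /andP[p0 p1]].
have p2 : p.2 ^+ 2 <= 1 by rewrite expr_le1.
rewrite -(ler_pXn2r (n := 2)) ?nnegrE// expr1n real_normK ?num_real//.
case: i => -[|[|[|//]]] i3 /=; apply: le_trans p2.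
- by rewrite (_ : cone_coord _ _ = p.1.1)// -pE lerDl sqr_ge0.
- by rewrite (_ : cone_coord _ _ = p.1.2)// -pE lerDr sqr_ge0.
- by rewrite (_ : cone_coord _ _ = p.2).
Qed.

(** [Q] carries the disc measure to the cone measure; [f] and [g] are first replaced by tame
    representatives, for which the transport formula holds. *)
Lemma inner_cone_Q m m' (f g : R * R * R -> R[i]) :
  poly_space (@cone_coord R) (@cone R) m f ->
  poly_space (@cone_coord R) (@cone R) m' g ->
  inner (cone_measure gamma) cone f g =
  inner (disc_measure gamma) disc (f \o @Q R) (g \o @Q R).
Proof.
move=> /(poly_space_tame_on measurable_cone_coord cone_coord_le1)[f' tf ff].
move=> /(poly_space_tame_on measurable_cone_coord cone_coord_le1)[g' tg gg].
have [nu1 nu1E] := cone_measure_measure gamma_gt.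
have [nu2 nu2E] := disc_measure_measure gamma_gt.
have E1 : cone_measure gamma = nu1 by apply/funext => A; rewrite nu1E.
have E2 : disc_measure gamma = nu2 by apply/funext => A; rewrite nu2E.
have IQ h : measurable_fun setT h ->
    (\int[nu1]_(p in cone) h p = \int[nu2]_(z in disc) h (Q z))%E.
  by move=> mh; rewrite -E1 -E2; exact: integral_cone_measure_Q.
rewrite E1 E2 (eq_inner nu1 ff gg).
have -> : inner nu2 disc (f \o @Q R) (g \o @Q R) =
    inner nu2 disc (f' \o @Q R) (g' \o @Q R).
  by apply: eq_inner => z Dz /=; [apply: ff|apply: gg]; exact: Q_cone.
have [mr mi _] : tame (@cone R) (fun x => f' x * (g' x)^*).
  by apply: tameM => //; exact: tame_conj.
apply: complex_inj => /=; congr fine.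
- by rewrite IQ//; exact/measurable_EFinP.
- by rewrite IQ//; exact/measurable_EFinP.
Qed.

Lemma inner_discN m m' (f g : R * R -> R[i]) :
  poly_space (@disc_coord R) (@disc R) m f ->
  poly_space (@disc_coord R) (@disc R) m' g ->
  inner (disc_measure gamma) disc (f \o -%R) (g \o -%R) =
  inner (disc_measure gamma) disc f g.
Proof.
move=> /(poly_space_tame_on measurable_disc_coord disc_coord_le1)[f' tf ff].
move=> /(poly_space_tame_on measurable_disc_coord disc_coord_le1)[g' tg gg].
have [nu2 nu2E] := disc_measure_measure gamma_gt.
have E2 : disc_measure gamma = nu2 by apply/funext => A; rewrite nu2E.
have IN h : measurable_fun setT h ->
    (\int[nu2]_(z in disc) h (- (z : R * R))%R = \int[nu2]_(z in disc) h z)%E.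
  by move=> mh; rewrite -E2; exact: integral_disc_measureN.
rewrite E2 (eq_inner nu2 ff gg).
have -> : inner nu2 disc (f \o -%R) (g \o -%R) =
    inner nu2 disc (f' \o -%R) (g' \o -%R).
  by apply: eq_inner => z Dz /=; [apply: ff|apply: gg]; exact: discN.
have [mr mi _] : tame (@disc R) (fun x => f' x * (g' x)^*).
  by apply: tameM => //; exact: tame_conj.
apply: complex_inj => /=; congr fine.
- by apply: (IN (fun z => (complex.Re (f' z * (g' z)^*))%:E)); exact/measurable_EFinP.
- by apply: (IN (fun z => (complex.Im (f' z * (g' z)^*))%:E)); exact/measurable_EFinP.
Qed.

End cone_disc_inner.

(** * Equality of the two kernels *)

Theorem theorem5p1 (R : realType) (gamma : R) (n : nat)
    (KV : R * R * R -> R * R * R -> R[i]) (KB : R * R -> R * R -> R[i]) :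
  -1 < gamma ->
  cone_kernel gamma n KV ->
  disc_kernel gamma (2 * n)%N KB ->
  forall z w : R * R, disc z -> disc w ->
    KV (Q z) (Q w) = even_part KB z w.
Proof.
move=> gamma_gt [N [P [oP KVE]]] [M [B [oB KBE]]] z w Dz Dw.
have [nu1 nu1E] := cone_measure_measure gamma_gt.
have [nu2 nu2E] := disc_measure_measure gamma_gt.
have E1 : cone_measure gamma = nu1 by apply/funext => A; rewrite nu1E.
have E2 : disc_measure gamma = nu2 by apply/funext => A; rewrite nu2E.
have fin1 : (nu1 (@cone R) < +oo)%E by rewrite nu1E; exact: cone_measure_fin.
have fin2 : (nu2 (@disc R) < +oo)%E by rewrite nu2E; exact: disc_measure_fin.
have mC := @measurable_cone R; have mD := @measurable_disc R.
have innerQ := inner_cone_Q gamma_gt; have innerN := inner_discN gamma_gt.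
rewrite E1 E2 in oP oB innerQ innerN.
have tC f m : poly_space (@cone_coord R) (@cone R) m f -> tame_on (@cone R) f.
  exact: (poly_space_tame_on measurable_cone_coord cone_coord_le1).
have tD f m : poly_space (@disc_coord R) (@disc R) m f -> tame_on (@disc R) f.
  exact: (poly_space_tame_on measurable_disc_coord disc_coord_le1).
have [EP _ _] := oP; have [EB _ _] := oB.
pose p l := P l \o @Q R.
have Ep l : poly_space (@disc_coord R) (@disc R) (2 * n) (p l).
  exact/poly_space_comp_Q/EP.
have pN l : p l \o -%R = p l.
  by apply/funext => x; rewrite /p/= /Q/= !sqrrN mulrN mulrN mulNr opprK.
(* [G m] is the even part of [B m], read as a polynomial function on the cone. *)
have /choice[G GP] m : exists g, poly_space (@cone_coord R) (@cone R) n g /\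
    forall z, disc z -> 2^-1 * (B m z + B m (- (z : R * R))) = g (Q z).
  by have [g ? ?] := even_poly_space (EB m); exists g.
have EG m : poly_space (@cone_coord R) (@cone R) n (G m) by have [] := GP m.
have GE m x : disc x -> 2^-1 * (B m x + B m (- (x : R * R))) = G m (Q x).
  by have [_] := GP m; apply.
(* The coefficients of [p l] in the basis [B] are the conjugates of those of [G m] in the basis [P],
   because the odd part of [B m] is orthogonal to the even function [p l]. *)
have GpB m l : inner nu2 (@disc R) (p l) (B m) = (inner nu1 (@cone R) (G m) (P l))^*.
  have GQ := poly_space_comp_Q (EG m).
  (* On the disc the reflection of [B m] is [2 (G m \o Q) - B m], again a polynomial function. *)
  have tBN : tame_on (@disc R) (B m \o -%R).
    apply: (tD _ (2 * n)%N); apply: (poly_space_eq _ (poly_spaceD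
      (poly_spaceZ 2 GQ) (poly_spaceZ (-1) (EB m)))) => x Dx /=.
    by rewrite -GE// mulN1r mulVKf ?pnatr_eq0// addrAC subrr add0r.
  rewrite (innerQ _ _ _ _ (EG m) (EP l)) -/(p l).
  pose F (i : 'I_2) := if i == 0 then B m else B m \o -%R.
  have -> : inner nu2 disc (G m \o @Q R) (p l) =
      inner nu2 disc (fun x => \sum_(i < 2) 2^-1 * F i x) (p l).
    apply: eq_inner => // x Dx /=.
    by rewrite big_ord_recl big_ord1 -mulrDr /F/= GE.
  rewrite inner_suml//; last 2 first.
  - by move=> i; rewrite /F; case: ifP => _ //; exact: tD (EB m).
  - exact: tD (Ep l).
  (* Writing the second [p l] as its own reflection lets [innerN] identify the two halves. *)
  rewrite big_ord_recl big_ord1 /F/= -[X in _ + _ * inner _ _ _ X]pN.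
  rewrite (innerN _ _ _ _ (EB m) (Ep l)) -mulrDl.
  rewrite (_ : 2^-1 + 2^-1 = 1 :> R[i]); last by field.
  by rewrite mul1r (innerC mD fin2 (tD _ _ (EB m)) (tD _ _ (Ep l))).
rewrite KVE; [|exact: Q_cone..].
rewrite /even_part !KBE//; last exact: discN.
rewrite -big_split/= mulr_sumr.
(* Averaging over [w] and [- w] acts on the second argument only, where it replaces [B m] by its
   even part. *)
transitivity (\sum_(m < M) B m z * (G m (Q w))^*); last first.
  apply: eq_bigr => m _; rewrite -GE// -mulrDr mulrCA; congr (_ * _).
  by rewrite rmorphM rmorphD/= fmorphV rmorph_nat.
under [RHS]eq_bigr => m _.
  rewrite (orthonormal_expansion mC fin1 oP (fun f => tC f n) (EG m))//; last exact: Q_cone.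
  rewrite rmorph_sum/= mulr_sumr.
  over.
(* After the exchange, the sum over [m] is, by [GpB], the expansion of [p l] in the basis [B] at
   [z]. *)
rewrite exchange_big/=; apply: eq_bigr => l _.
rewrite -[P l (Q z)]/(p l z).
rewrite (orthonormal_expansion mD fin2 oB (fun f => tD f (2 * n)%N) (Ep l))//.
rewrite mulr_suml; apply: eq_bigr => m _.
by rewrite GpB rmorphM/=; ring.
Qed.
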